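(* Let $\alpha\in\mathbb{R}\setminus\mathbb{Q}$ with $0\le\beta(\alpha)<\infty$, let $\eta>C_1\beta(\alpha)$, let $f$ be real analytic on $\mathbb{R}/\mathbb{Z}$ and analytic on the strip $\Delta_{C_2\eta}$, and let $0<|\lambda|\le\lambda_0$, where $C_1,C_2$ and $\lambda_0=\lambda_0(f,\eta,\alpha)$ are as in the context. Then there is a constant $m_\star$ (depending on $\lambda,f,\alpha,\eta$) such that for every $m\in\mathbb{Z}\setminus\{0\}$ with $|m|\ge m_\star$, $$E_m^+-E_m^-\le e^{-\frac{\eta}{3}n},$$ where $n=n(E_m^+)$ is the resonance index associated with $E=E_m^+$.
   Context: $(H_{\lambda f,\alpha,\theta}x)_n=x_{n+1}+x_{n-1}+\lambda f(\theta+n\alpha)x_n$ on $\ell^2(\mathbb{Z})$, with $\theta$-independent spectrum $\Sigma_{\lambda f,\alpha}$. $\beta(\alpha)=\limsup_{k\to\infty}\frac{-\ln\|k\alpha\|_{\mathbb{R}/\mathbb{Z}}}{|k|}$, $\|x\|_{\mathbb{R}/\mathbb{Z}}=\min_{k\in\mathbb{Z}}|x-k|$. $\Delta_\delta=\{z\in\mathbb{C}/\mathbb{Z}:|\Im z|\le\delta\}$ and $\|v\|_\delta=\sup_{z\in\Delta_\delta}\|v(z)\|$. $S_{\lambda f,E}(x)=\begin{pmatrix}E-\lambda f(x)&-1\\1&0\end{pmatrix}$ and $A^E_k(x)=S_{\lambda f,E}(x+(k-1)\alpha)\cdots S_{\lambda f,E}(x)$. $\rho_{\lambda f,\alpha}(E)\in[0,\frac12]$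 is the fibered rotation number of the cocycle $(\alpha,S_{\lambda f,E})$, i.e. the average rotation (in units of $2\pi$) of directions under iteration of $(x,v)\mapsto(x+\alpha,S_{\lambda f,E}(x)v)$, normalized to be continuous and non-increasing in $E$ from $\frac12$ (for $E\le\min\Sigma_{\lambda f,\alpha}$) to $0$ (for $E\ge\max\Sigma_{\lambda f,\alpha}$); equivalently $1-2\rho_{\lambda f,\alpha}$ is the integrated density of states. For $m\ne0$, $[E_m^-,E_m^+]=\{E:2\rho_{\lambda f,\alpha}(E)=m\alpha\bmod\mathbb{Z}\}$. Dual operator: $(\widehat H_{\lambda f,\alpha,\theta}x)_n=\sum_{k}\lambda\widehat f_kx_{n-k}+2\cos(2\pi(\theta+n\alpha))x_n$, with $\widehat f_k$ the Fourier coefficients of $f$. For each $E\in\Sigma_{\lambda f,\alpha}$ there are (Avila–Jitomirskaya) $\theta(E)\in\mathbb{R}/\mathbb{Z}$ and a sequence $\widehat u$ with $\widehat u_0=1$, $|\widehat u_k|\le1$, $\widehat H_{\lambda f,\alpha,\theta(E)}\widehat u=E\widehat u$; fix such a choice for each $E$. The constants: $C_1,C_2$ are fixed sufficiently large absolute constants, and $\lambda_0=\lambda_0(f,\eta,\alpha)>0$ is a threshold for which the following known results (Liu–Yuan) hold whenever $0<|\lambda|\le\lambda_0$, $E\in\Sigma_{\lambda f,\alpha}$ and $2\rho_{\lambda f,\alpha}(E)=m\alpha\bmod\mathbb{Z}$: (a) there is $\widetilde n\in\mathbb{Z}$ with $2\theta(E)=\widetilde n\alpha\bmod\mathbb{Z}$;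 put $n=n(E)=|\widetilde n|$ (the resonance index); (b) $|m|\le Cn$ if $|m|$ is larger than a constant depending on $\lambda,f,\alpha$; (c) $|\widehat u_k|\le C_\star e^{-2\pi\eta|k|}$ for $|k|\ge3n$; (d) $\sup_{0\le k\le e^{\eta n}}\|A^E_k\|_\eta\le C_\star e^{C\beta(\alpha)n}$. Here $C$ is absolute and $C_\star$ depends on $\lambda,f,\alpha,\eta$ only. *)

(* Defs.v *)
From Stdlib Require Import Reals ZArith Lra Lia Psatz.
From Coquelicot Require Import Coquelicot.
Open Scope R_scope.

(** * Arithmetic of the frequency *)

Definition irrational (x : R) : Prop :=
  forall p q : Z, q <> 0%Z -> x <> IZR p / IZR q.

Definition eq_mod_Z (x y : R) : Prop := exists k : Z, x - y = IZR k.

Definition dist_Z (x : R) : R :=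
  real (Glb_Rbar (fun d => exists k : Z, d = Rabs (x - IZR k))).

(* The term k = 0 is a junk value, which the limsup does not see.  As
   dist_Z (- x) = dist_Z x, positive k suffice. *)
Definition beta (alpha : R) : Rbar :=
  LimSup_seq (fun k : nat => - ln (dist_Z (INR k * alpha)) / INR k).

(** * Two-sided sequences *)

Definition is_Zseries (a : Z -> C) (l : C) : Prop :=
  exists l1 l2 : C,
    is_series (V := C_R_NormedModule) (fun j : nat => a (Z.of_nat j)) l1 /\
    is_series (V := C_R_NormedModule) (fun j : nat => a (- Z.of_nat (S j))%Z) l2 /\
    l = (l1 + l2)%C.

Definition in_l2 (x : Z -> C) : Prop :=
  ex_series (fun j : nat => Cmod (x (Z.of_nat j)) ^ 2) /\
  ex_series (fun j : nat => Cmod (x (- Z.of_nat (S j))%Z) ^ 2).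

Definition l2_norm (x : Z -> C) : R :=
  sqrt (Series (fun j : nat => Cmod (x (Z.of_nat j)) ^ 2) +
        Series (fun j : nat => Cmod (x (- Z.of_nat (S j))%Z) ^ 2)).

(* T - z has a bounded everywhere defined two-sided inverse on l^2(Z). *)
Definition in_resolvent_set (T : (Z -> C) -> (Z -> C)) (z : C) : Prop :=
  exists (G : (Z -> C) -> (Z -> C)) (M : R),
    forall y : Z -> C, in_l2 y ->
      in_l2 (G y) /\
      l2_norm (G y) <= M * l2_norm y /\
      (forall n, T (G y) n - z * G y n = y n)%C /\
      (forall n, G (fun k => T y k - z * y k)%C n = y n).

Definition in_spectrum (T : (Z -> C) -> (Z -> C)) (z : C) : Prop :=
  ~ in_resolvent_set T z.

(** * Analytic sampling functions *)

Definition strip (delta : R) (z : C) : Prop := Rabs (Im z) <= delta.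

(* A function on the closed strip of C/Z is a 1-periodic function of z : C, of
   which only the values on the strip matter.  Analyticity on the closed strip
   is holomorphy in a neighbourhood of each of its points. *)
Definition real_analytic_on_strip (delta : R) (f : C -> C) : Prop :=
  (forall z, strip delta z -> f (z + 1)%C = f z) /\
  (forall x : R, Im (f (RtoC x)) = 0) /\
  (forall z, strip delta z ->
     locally (T := C_UniformSpace) z
       (fun w => ex_derive (K := C_AbsRing) (V := C_NormedModule) f w)).

Definition expi (t : R) : C := (cos t, sin t).

Definition fourier_coeff (f : C -> C) (k : Z) : C :=
  RInt (V := C_R_CompleteNormedModule)
    (fun x : R => f (RtoC x) * expi (- (2 * PI * IZR k * x)))%C 0 1.

(** * The operator and its dual *)

Definition schrodinger (lam : R) (f : C -> C) (alpha theta : R)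
    (x : Z -> C) (n : Z) : C :=
  (x (n + 1)%Z + x (n - 1)%Z
   + RtoC lam * f (RtoC (theta + IZR n * alpha)) * x n)%C.

(* For irrational alpha and continuous f the spectrum does not depend on the
   phase; it is taken at phase 0. *)
Definition Sigma (lam : R) (f : C -> C) (alpha E : R) : Prop :=
  in_spectrum (schrodinger lam f alpha 0) (RtoC E).

Definition is_dual_solution (lam : R) (f : C -> C) (alpha theta E : R)
    (u : Z -> C) : Prop :=
  forall n : Z, exists s : C,
    is_Zseries (fun k => RtoC lam * fourier_coeff f k * u (n - k)%Z)%C s /\
    (s + RtoC (2 * cos (2 * PI * (theta + IZR n * alpha))) * u n
     = RtoC E * u n)%C.

(** * The Schrodinger cocycle *)

Definition cocycle_mat (lam : R) (f : C -> C) (E : R) (z : C) : @matrix C 2 2 :=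
  [ [ (RtoC E - RtoC lam * f z)%C , RtoC (- 1) ] , [ RtoC 1 , RtoC 0 ] ].

Fixpoint cocycle_iter (lam : R) (f : C -> C) (alpha E : R) (k : nat) (z : C)
    : @matrix C 2 2 :=
  match k with
  | O => Mone (T := C_Ring)
  | S j => Mmult (T := C_Ring)
             (cocycle_mat lam f E (z + RtoC (INR j * alpha))%C)
             (cocycle_iter lam f alpha E j z)
  end.

Definition col_norm (v : @matrix C 2 1) : R :=
  sqrt (Cmod (coeff_mat (RtoC 0) v 0 0) ^ 2 + Cmod (coeff_mat (RtoC 0) v 1 0) ^ 2).

Definition op_norm (M : @matrix C 2 2) : R :=
  real (Lub_Rbar (fun l => exists v : @matrix C 2 1,
          col_norm v <= 1 /\ l = col_norm (Mmult (T := C_Ring) M v))).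

Definition strip_norm (delta : R) (M : C -> @matrix C 2 2) : Rbar :=
  Lub_Rbar (fun l => exists z : C, strip delta z /\ l = op_norm (M z)).

(** * Fibered rotation number *)

(* Action of the matrix (t, -1; 1, 0) on a real vector. *)
Definition sl2_step (t : R) (v : R * R) : R * R := (t * fst v - snd v, fst v).

(* Angle from v to w, in units of 2 pi, in the branch ]-1/4, 3/4[.  Here c and s
   are |v||w| times the cosine and the sine of that angle.  The only angle out
   of reach is -1/4, which never occurs for w = sl2_step t v (turn_spec below).
   So this branch is continuous in v and t: it is the lift to the universal
   cover which sends the direction (0,1) to (-1,0) by a quarter turn, and for
   which the average rotation decreases from 1/2 to 0 as the energy goes from -oo to
   +oo. *)
Definition turn (v w : R * R) : R :=
  let c := fst v * fst w + snd v * snd w in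
  let s := fst v * snd w - snd v * fst w in
  (if Rlt_dec 0 c then atan (s / c)
   else if Rlt_dec c 0 then PI + atan (s / c)
   else PI / 2) / (2 * PI).

Lemma turn_spec (t : R) (v : R * R) :
  v <> (0, 0) ->
  - / 4 < turn v (sl2_step t v) < 3 / 4 /\
  exists r : R, 0 < r /\
    let phi := 2 * PI * turn v (sl2_step t v) in
    sl2_step t v = (r * (cos phi * fst v - sin phi * snd v),
                    r * (sin phi * fst v + cos phi * snd v)).
Proof.
  destruct v as [a b]; intros hv; unfold turn, sl2_step; cbn [fst snd].
  set (c := a * (t * a - b) + b * a).
  set (s := a * a - b * (t * a - b)).
  assert (hN : 0 < a * a + b * b).
  { destruct (Req_dec a 0) as [-> | ha]; [ | nra ].
    destruct (Req_dec b 0) as [-> | hb]; [ | nra ].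
    now elim hv. }
  assert (hpi := PI_RGT_0).
  set (N := a * a + b * b) in *.
  (* r |v|^2 e^{i phi} = c + i s is all that is needed. *)
  assert (key : forall r phi, r * N * cos phi = c -> r * N * sin phi = s ->
     (t * a - b, a) = (r * (cos phi * a - sin phi * b),
                       r * (sin phi * a + cos phi * b))).
  { intros r phi h1 h2; f_equal; apply (Rmult_eq_reg_l N); try lra.
    - replace (N * (r * (cos phi * a - sin phi * b)))
        with ((r * N * cos phi) * a - (r * N * sin phi) * b) by ring.
      rewrite h1, h2; unfold N, c, s; ring.
    - replace (N * (r * (sin phi * a + cos phi * b)))
        with ((r * N * sin phi) * a + (r * N * cos phi) * b) by ring.
      rewrite h1, h2; unfold N, c, s; ring. }
  assert (hat := atan_bound (s / c)).
  assert (hcos : 0 < cos (atan (s / c))) by (apply cos_gt_0; lra).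
  assert (htan : c <> 0 -> c * sin (atan (s / c)) = s * cos (atan (s / c))).
  { intros hc. assert (h := tan_atan (s / c)); unfold tan in h.
    apply (Rmult_eq_reg_r (/ cos (atan (s / c)))); [ | apply Rinv_neq_0_compat; lra ].
    replace (c * sin (atan (s / c)) * / cos (atan (s / c)))
      with (c * (sin (atan (s / c)) / cos (atan (s / c)))) by (field; lra).
    rewrite h; field; lra. }
  destruct (Rlt_dec 0 c) as [hc | hc].
  - specialize (htan ltac:(lra)).
    split.
    + split; apply (Rmult_lt_reg_r (2 * PI)); try lra; field_simplify; lra.
    + exists (c / (N * cos (atan (s / c)))); split.
      * apply Rdiv_lt_0_compat; nra.
      * cbv zeta. apply key;
          replace (2 * PI * (atan (s / c) / (2 * PI))) with (atan (s / c)) by (field; lra).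
        -- field; lra.
        -- replace (c / (N * cos (atan (s / c))) * N * sin (atan (s / c)))
             with (c * sin (atan (s / c)) / cos (atan (s / c))) by (field; lra).
           rewrite htan; field; lra.
  - destruct (Rlt_dec c 0) as [hc' | hc'].
    + specialize (htan ltac:(lra)).
      split.
      * split; apply (Rmult_lt_reg_r (2 * PI)); try lra; field_simplify; lra.
      * exists (- c / (N * cos (atan (s / c)))); split.
        -- apply Rdiv_lt_0_compat; nra.
        -- cbv zeta. apply key;
           replace (2 * PI * ((PI + atan (s / c)) / (2 * PI))) with (atan (s / c) + PI)
             by (field; lra); rewrite ?neg_cos, ?neg_sin.
           ++ field; lra.
           ++ replace (- c / (N * cos (atan (s / c))) * N * - sin (atan (s / c)))
                with (c * sin (atan (s / c)) / cos (atan (s / c))) by (field; lra).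
              rewrite htan; field; lra.
    + assert (hc0 : c = 0) by lra.
      assert (hs : 0 < s).
      { assert (h : t * a * a = 0) by (unfold c in hc0; lra).
        assert (hta : t * a = 0).
        { destruct (Rmult_integral _ _ h) as [h' | h']; [ exact h' | rewrite h'; ring ]. }
        unfold s; rewrite hta; unfold N in hN; lra. }
      split.
      * split; apply (Rmult_lt_reg_r (2 * PI)); try lra; field_simplify; lra.
      * exists (s / N); split; [ apply Rdiv_lt_0_compat; lra | ].
        cbv zeta. apply key;
          replace (2 * PI * (PI / 2 / (2 * PI))) with (PI / 2) by (field; lra);
          rewrite ?cos_PI2, ?sin_PI2, ?hc0; field; lra.
Qed.

(* E - lam f(x) for real x, where f is real valued. *)
Definition cocycle_trace (lam : R) (f : C -> C) (E x : R) : R :=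
  E - lam * Re (f (RtoC x)).

Fixpoint direction (lam : R) (f : C -> C) (alpha E x : R) (v : R * R) (k : nat)
    : R * R :=
  match k with
  | O => v
  | S j => sl2_step (cocycle_trace lam f E (x + INR j * alpha))
             (direction lam f alpha E x v j)
  end.

(* Average rotation along an orbit.  For irrational alpha and continuous f the
   limit exists and does not depend on the starting point (x, v), taken here to
   be x = 0, v = (1, 0). *)
Definition rho (lam : R) (f : C -> C) (alpha E : R) : R :=
  let v := direction lam f alpha E 0 (1, 0) in
  real (Lim_seq (fun n => sum_n (fun k => turn (v k) (v (S k))) n / INR (S n))).

(** * Gaps and resonances *)

Definition gap_set (lam : R) (f : C -> C) (alpha : R) (m : Z) (E : R) : Prop :=
  eq_mod_Z (2 * rho lam f alpha E) (IZR m * alpha).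

Definition E_plus (lam : R) (f : C -> C) (alpha : R) (m : Z) : R :=
  real (Lub_Rbar (gap_set lam f alpha m)).

Definition E_minus (lam : R) (f : C -> C) (alpha : R) (m : Z) : R :=
  real (Glb_Rbar (gap_set lam f alpha m)).

(* There is at most one such n when alpha is irrational. *)
Definition is_resonance_index (alpha theta : R) (n : Z) : Prop :=
  exists nt : Z, eq_mod_Z (2 * theta) (IZR nt * alpha) /\ n = Z.abs nt.

(* theta lam E and u lam E are the phase and the bounded dual solution chosen
   at the energy E for the coupling lam. *)
Definition dual_choice (f : C -> C) (alpha : R)
    (theta : R -> R -> R) (u : R -> R -> Z -> C) : Prop :=
  forall lam E : R, Sigma lam f alpha E ->
    u lam E 0%Z = RtoC 1 /\
    (forall k, Cmod (u lam E k) <= 1) /\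
    is_dual_solution lam f alpha (theta lam E) E (u lam E).

Definition resonance_estimates (C0 alpha eta : R) (f : C -> C) (lam : R)
    (theta : R -> R -> R) (u : R -> R -> Z -> C) (Cstar M : R) : Prop :=
  forall (E : R) (m : Z),
    Sigma lam f alpha E ->
    eq_mod_Z (2 * rho lam f alpha E) (IZR m * alpha) ->
    exists n : Z,
      is_resonance_index alpha (theta lam E) n /\
      (M < Rabs (IZR m) -> Rabs (IZR m) <= C0 * IZR n) /\
      (forall k : Z, (3 * n <= Z.abs k)%Z ->
         Cmod (u lam E k) <= Cstar * exp (- (2 * PI * eta * Rabs (IZR k)))) /\
      (forall k : nat, INR k <= exp (eta * IZR n) ->
         Rbar_le (strip_norm eta (cocycle_iter lam f alpha E k))
                 (Finite (Cstar * exp (C0 * real (beta alpha) * IZR n)))).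

Definition is_threshold (C0 alpha eta : R) (f : C -> C)
    (theta : R -> R -> R) (u : R -> R -> Z -> C) (lam0 : R) : Prop :=
  0 < lam0 /\
  forall lam : R, 0 < Rabs lam <= lam0 ->
    exists Cstar M : R, resonance_estimates C0 alpha eta f lam theta u Cstar M.

(* Main.v *)
Require Import Defs.
From Stdlib Require Import Reals ZArith Lra Lia Psatz.
From Coquelicot Require Import Coquelicot.
Open Scope R_scope.

(** Only the bound (d) on the transfer matrices over the real axis matters.
    Let E = E_m^+, let D bound the squared first rows of the transfer matrices
    A_k at E over a time of order e^(eta n), uniformly in the phase, and lower
    the energy by tau.  By variation of constants the solutions at E - tau are
    A_k c_k, where c_k turns only counterclockwise and, as det A_k = 1, by at
    least tau / (64 D) in every two steps.  With tau = e^(-eta n / 3) the number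
    of steps e^(eta n) far exceeds D / tau, so every block of that length gains
    half a turn and rho (E - tau) > rho E: the gap does not reach down to
    E - tau.

    The same device bounds the gain of a block from above for small tau, whence
    rho is continuous, with no appeal to unique ergodicity.  E_m^+ is
    in the spectrum because otherwise rho is constant around it: a large
    rotation difference between E - eps and E + eps on a box yields three
    Dirichlet eigenvalues there, and a combination of the three eigenvectors
    vanishing at both ends of the box is an approximate eigenvector of the
    whole operator. *)

(** * Lifted action on angles *)

(** Gains are counted in units of [PI] because a matrix acts alike on [v] and [- v]. Every lifted
    map therefore commutes with translation by [PI] and is increasing, so a lead of [i * PI] passes
    undamaged through all later steps. A smaller lead stays positive but may shrink without control,
    since the maps are not isometries. This is why a block has to be long enough to gain a full half
    turn, and why leads of successive blocks then simply add up.

    Working with vectors fixes angles only modulo [2 * PI]. Each identification of lifted angles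
    therefore combines a vector identity with an a priori bound on the difference. The smallness
    [tau * D <= / 2] supplies that bound: a single kick turns by at most one radian.

    Averages are compared through [Lim_seq], which for a bounded sequence is the half sum of its
    upper and lower limits and so respects inequalities that hold eventually. *)

Definition is_angle (v : R * R) (phi : R) : Prop :=
  exists r : R, 0 < r /\ v = (r * cos phi, r * sin phi).

(** The difference [d] has [sin d = 0] and [cos d > 0], so it is a multiple of [2 * PI], and the
    bound leaves only zero. This selects the branch whenever a lifted angle has to be computed. *)
Lemma is_angle_unique (v : R * R) (phi psi : R) :
  is_angle v phi -> is_angle v psi -> Rabs (phi - psi) < 2 * PI -> phi = psi.
Proof.
  intros [r [hr ->]] [r' [hr' h]] hd.
  injection h as hc hs.
  set (d := phi - psi) in *.
  assert (hsin : sin d = 0).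
  { apply (Rmult_eq_reg_l r); [ | lra ].
    unfold d; rewrite sin_minus.
    replace (r * (sin phi * cos psi - cos phi * sin psi))
      with (r * sin phi * cos psi - r * cos phi * sin psi) by ring.
    rewrite hs, hc; ring. }
  assert (hcos : 0 < cos d).
  { apply (Rmult_lt_reg_l r); [ lra | ].
    unfold d; rewrite cos_minus.
    replace (r * (cos phi * cos psi + sin phi * sin psi))
      with (r * cos phi * cos psi + r * sin phi * sin psi) by ring.
    rewrite hs, hc.
    assert (h1 := sin2_cos2 psi); unfold Rsqr in h1.
    replace (r' * cos psi * cos psi + r' * sin psi * sin psi)
      with (r' * (sin psi * sin psi + cos psi * cos psi)) by ring.
    rewrite h1; lra. }
  assert (hh : sin (d / 2) = 0).
  { replace d with (2 * (d / 2)) in hsin, hcos by field.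
    rewrite sin_2a in hsin. rewrite cos_2a in hcos.
    assert (cos (d / 2) <> 0) by (intros h0; rewrite h0 in hcos; nra).
    apply (Rmult_eq_reg_r (cos (d / 2))); lra. }
  apply Rabs_def2 in hd.
  destruct (Rtotal_order d 0) as [h0 | [h0 | h0]].
  - assert (0 < sin (- (d / 2))) by (apply sin_gt_0; lra).
    rewrite sin_neg in H; lra.
  - unfold d in h0; lra.
  - assert (0 < sin (d / 2)) by (apply sin_gt_0; lra). lra.
Qed.

Lemma is_angle_neq0 (v : R * R) (phi : R) : is_angle v phi -> v <> (0, 0).
Proof.
  intros [r [hr ->]] h; injection h as h1 h2.
  assert (h3 := sin2_cos2 phi); unfold Rsqr in h3.
  assert (cos phi = 0) by (apply (Rmult_eq_reg_l r); lra).
  assert (sin phi = 0) by (apply (Rmult_eq_reg_l r); lra).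
  nra.
Qed.

Lemma is_angle_cos_sin (phi : R) : is_angle (cos phi, sin phi) phi.
Proof. exists 1; split; [ lra | f_equal; ring ]. Qed.

(** Both the cosine and the sine part scale by [k * k], so negative [k] is allowed; [k = -1] gives
    the commutation of [lift] with translation by [PI]. *)
Lemma turn_scale (k a b c d : R) :
  k <> 0 -> turn (k * a, k * b) (k * c, k * d) = turn (a, b) (c, d).
Proof.
  intros hk; unfold turn; cbn [fst snd].
  assert (hk2 : 0 < k * k) by nra.
  replace (k * a * (k * c) + k * b * (k * d)) with (k * k * (a * c + b * d)) by ring.
  replace (k * a * (k * d) - k * b * (k * c)) with (k * k * (a * d - b * c)) by ring.
  set (p := a * c + b * d); set (q := a * d - b * c).
  assert (hq : p <> 0 -> k * k * q / (k * k * p) = q / p) by (intros; field; auto).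
  destruct (Rlt_dec 0 p), (Rlt_dec 0 (k * k * p)); try (exfalso; nra).
  - rewrite hq; [ reflexivity | lra ].
  - destruct (Rlt_dec p 0), (Rlt_dec (k * k * p) 0); try (exfalso; nra).
    + rewrite hq; [ reflexivity | lra ].
    + reflexivity.
Qed.

(* The action of the matrix (t, -1; 1, 0) on directions, lifted to angles in
   radians. *)
Definition lift (t phi : R) : R :=
  phi + 2 * PI * turn (cos phi, sin phi) (sl2_step t (cos phi, sin phi)).

Lemma sl2_step_scale (t k a b : R) :
  sl2_step t (k * a, k * b)
  = (k * fst (sl2_step t (a, b)), k * snd (sl2_step t (a, b))).
Proof. unfold sl2_step; cbn; f_equal; ring. Qed.

Lemma lift_bounds (t phi : R) : phi - PI / 2 < lift t phi < phi + 3 * PI / 2.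
Proof.
  assert (h := PI_RGT_0).
  destruct (turn_spec t (cos phi, sin phi)) as [hb _].
  { apply (is_angle_neq0 _ phi), is_angle_cos_sin. }
  unfold lift; split; nra.
Qed.

Lemma lift_is_angle (t : R) (v : R * R) (phi : R) :
  is_angle v phi -> is_angle (sl2_step t v) (lift t phi).
Proof.
  intros [r [hr ->]].
  destruct (turn_spec t (cos phi, sin phi)) as [_ [r' [hr' h]]].
  { apply (is_angle_neq0 _ phi), is_angle_cos_sin. }
  cbv zeta in h; cbn [fst snd] in h.
  exists (r * r'); split; [ nra | ].
  unfold lift; rewrite sl2_step_scale.
  set (a := 2 * PI * turn _ _) in *.
  rewrite h, cos_plus, sin_plus; cbn [fst snd]; f_equal; ring.
Qed.

Lemma turn_lift (t : R) (v : R * R) (phi : R) :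
  is_angle v phi -> 2 * PI * turn v (sl2_step t v) = lift t phi - phi.
Proof.
  intros [r [hr ->]]; unfold lift.
  rewrite sl2_step_scale, turn_scale by lra.
  rewrite <- surjective_pairing; ring.
Qed.

Lemma lift_shift (t phi : R) : lift t (phi + PI) = lift t phi + PI.
Proof.
  unfold lift; rewrite neg_cos, neg_sin.
  replace (- cos phi, - sin phi) with (-1 * cos phi, -1 * sin phi) by (f_equal; ring).
  rewrite sl2_step_scale, turn_scale by lra.
  rewrite <- surjective_pairing; ring.
Qed.

Lemma shift_IZR (h : R -> R) :
  (forall x, h (x + PI) = h x + PI) ->
  forall (k : Z) (x : R), h (x + IZR k * PI) = h x + IZR k * PI.
Proof.
  intros hs k.
  assert (hn : forall (n : nat) x, h (x + INR n * PI) = h x + INR n * PI).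
  { induction n as [ | n IH]; intros x.
    - cbn [INR]; replace (x + 0 * PI) with x by ring; ring.
    - rewrite S_INR. replace (x + (INR n + 1) * PI) with (x + INR n * PI + PI) by ring.
      rewrite hs, IH; ring. }
  intros x.
  destruct (Z_le_gt_dec 0 k) as [hk | hk].
  - rewrite <- (Z2Nat.id k hk), <- INR_IZR_INZ; apply hn.
  - assert (e : IZR k = - INR (Z.to_nat (- k))).
    { rewrite INR_IZR_INZ, Z2Nat.id by lia. rewrite opp_IZR; ring. }
    rewrite e. specialize (hn (Z.to_nat (- k)) (x + - INR (Z.to_nat (- k)) * PI)).
    replace (x + - INR (Z.to_nat (- k)) * PI + INR (Z.to_nat (- k)) * PI) with x in hn by ring.
    lra.
Qed.

Lemma lift_shift_IZR (t : R) (k : Z) (phi : R) :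
  lift t (phi + IZR k * PI) = lift t phi + IZR k * PI.
Proof. apply (shift_IZR (lift t)), lift_shift. Qed.

(** The image of [(cos phi, sin phi)] is [cos phi] times [(t - tan phi, 1)], which lies in the upper
    half plane and has cotangent [t - tan phi]. Monotonicity in both [t] and [phi] is read off from
    this chart. *)
Lemma lift_base (t phi : R) :
  - (PI / 2) < phi < PI / 2 -> lift t phi = PI / 2 - atan (t - tan phi).
Proof.
  intros hphi.
  assert (hpi := PI_RGT_0).
  assert (hat := atan_bound (t - tan phi)).
  assert (hb := lift_bounds t phi).
  apply (is_angle_unique (sl2_step t (cos phi, sin phi))).
  - apply lift_is_angle, is_angle_cos_sin.
  - assert (hc : 0 < cos phi) by (apply cos_gt_0; lra).
    assert (hca : 0 < cos (atan (t - tan phi))) by (apply cos_gt_0; lra).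
    exists (cos phi / cos (atan (t - tan phi))); split.
    + apply Rdiv_lt_0_compat; lra.
    + rewrite cos_shift, sin_shift. unfold sl2_step; cbn [fst snd]; f_equal.
      * assert (h := tan_atan (t - tan phi)).
        replace (cos phi / cos (atan (t - tan phi)) * sin (atan (t - tan phi)))
          with (cos phi * tan (atan (t - tan phi))) by (unfold tan at 1; field; lra).
        rewrite h; unfold tan; field; lra.
      * field; lra.
  - apply Rabs_def1; lra.
Qed.

(** The direction that the slope chart omits: [(0, -1)] goes to [(1, 0)] for every [t]. *)
Lemma lift_mPI2 (t : R) : lift t (- (PI / 2)) = 0.
Proof.
  assert (hpi := PI_RGT_0).
  assert (hb := lift_bounds t (- (PI / 2))).
  apply (is_angle_unique (sl2_step t (cos (- (PI / 2)), sin (- (PI / 2))))).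
  - apply lift_is_angle, is_angle_cos_sin.
  - exists 1; split; [ lra | ].
    rewrite cos_neg, sin_neg, cos_PI2, sin_PI2, cos_0, sin_0.
    unfold sl2_step; cbn; f_equal; ring.
  - apply Rabs_def1; lra.
Qed.

Lemma angle_decomp (phi : R) :
  exists (k : Z) (psi : R), - (PI / 2) <= psi < PI / 2 /\ phi = psi + IZR k * PI.
Proof.
  assert (hpi := PI_RGT_0).
  destruct (archimed (phi / PI - / 2)) as [h1 h2].
  set (k := up (phi / PI - / 2)) in *.
  exists k, (phi - IZR k * PI); split; [ | ring ].
  assert (e : phi = phi / PI * PI) by (field; lra).
  split; nra.
Qed.

Lemma lift_base_range (t phi : R) :
  - (PI / 2) <= phi < PI / 2 -> 0 <= lift t phi < PI.
Proof.
  intros [[h | <-] h']; assert (hpi := PI_RGT_0).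
  - rewrite lift_base by lra. assert (hat := atan_bound (t - tan phi)); lra.
  - rewrite lift_mPI2; lra.
Qed.

Lemma lift_increasing (t phi psi : R) : phi < psi -> lift t phi < lift t psi.
Proof.
  assert (hpi := PI_RGT_0).
  destruct (angle_decomp phi) as [k [x [hx ->]]].
  destruct (angle_decomp psi) as [l [y [hy ->]]].
  intros h; rewrite !lift_shift_IZR.
  destruct (Z.lt_trichotomy k l) as [hkl | [-> | hkl]].
  - assert (hkl' : IZR k + 1 <= IZR l) by (rewrite <- plus_IZR; apply IZR_le; lia).
    assert (h1 := lift_base_range t x hx). assert (h2 := lift_base_range t y hy). nra.
  - assert (hxy : x < y) by lra.
    destruct hx as [[hx | <-] hx'].
    + rewrite !lift_base by lra.
      assert (tan x < tan y) by (apply tan_increasing; lra).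
      assert (atan (t - tan y) < atan (t - tan x)) by (apply atan_increasing; lra).
      lra.
    + rewrite lift_mPI2, (lift_base t y) by lra.
      assert (hat := atan_bound (t - tan y)); lra.
  - assert (hkl' : IZR l + 1 <= IZR k) by (rewrite <- plus_IZR; apply IZR_le; lia).
    exfalso; nra.
Qed.

Lemma lift_le (t phi psi : R) : phi <= psi -> lift t phi <= lift t psi.
Proof. intros [h | ->]; [ apply Rlt_le, lift_increasing, h | lra ]. Qed.

(** The image of a vertical direction does not depend on [t], so all values [lift t phi] for fixed
    [phi] share one interval of length [PI]; inside it [atan] decides the order. *)
Lemma lift_window (t t' phi : R) :
  t' <= t -> lift t phi <= lift t' phi < lift t phi + PI.
Proof.
  intros ht. assert (hpi := PI_RGT_0).
  destruct (angle_decomp phi) as [k [x [hx ->]]].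
  rewrite !lift_shift_IZR.
  assert (h1 := lift_base_range t x hx). assert (h2 := lift_base_range t' x hx).
  split; [ | lra ].
  destruct hx as [[hx | <-] hx'].
  - rewrite !lift_base by lra.
    destruct ht as [ht | ->]; [ | lra ].
    assert (atan (t' - tan x) < atan (t - tan x)) by (apply atan_increasing; lra).
    lra.
  - rewrite !lift_mPI2; lra.
Qed.

Lemma atan_diff_le (x y : R) : x <= y -> atan y - atan x <= y - x.
Proof.
  intros hxy.
  destruct (MVT_gen atan x y (fun z => / (1 + z ^ 2))) as [c [_ hc]].
  - intros z _. rewrite is_derive_Reals. apply derivable_pt_lim_atan.
  - intros z _. apply derivable_continuous_pt, derivable_pt_atan.
  - rewrite hc.
    assert (0 < / (1 + c ^ 2) <= 1).
    { split; [ apply Rinv_0_lt_compat; nra | ].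
      rewrite <- Rinv_1 at 2. apply Rinv_le_contravar; nra. }
    nra.
Qed.

Lemma atan_ge_half (q : R) : 0 <= q <= 1 -> q / 2 <= atan q.
Proof.
  intros hq.
  destruct (MVT_gen atan 0 q (fun z => / (1 + z ^ 2))) as [c [hc1 hc]].
  - intros z _. rewrite is_derive_Reals. apply derivable_pt_lim_atan.
  - intros z _. apply derivable_continuous_pt, derivable_pt_atan.
  - rewrite atan_0 in hc. rewrite Rmin_left, Rmax_right in hc1 by lra.
    assert (/ 2 <= / (1 + c ^ 2)) by (apply Rinv_le_contravar; nra).
    nra.
Qed.

Lemma lift_lipschitz (t t' phi : R) : Rabs (lift t phi - lift t' phi) <= Rabs (t - t').
Proof.
  assert (hs : forall a b, b <= a -> Rabs (lift a phi - lift b phi) <= Rabs (a - b)).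
  { intros a b hab.
    destruct (lift_window a b phi hab) as [hw _].
    rewrite Rabs_left1, Rabs_pos_eq by lra.
    destruct (angle_decomp phi) as [k [x [hx ->]]].
    rewrite !lift_shift_IZR.
    destruct hx as [[hx | <-] hx'].
    - rewrite !lift_base by lra.
      assert (h := atan_diff_le (b - tan x) (a - tan x)). lra.
    - rewrite !lift_mPI2; lra. }
  destruct (Rle_dec t' t) as [h | h]; [ now apply hs | ].
  rewrite Rabs_minus_sym, (Rabs_minus_sym t). apply hs; lra.
Qed.

Lemma lift_surjective (t y : R) : exists phi : R, lift t phi = y.
Proof.
  assert (hpi := PI_RGT_0).
  destruct (angle_decomp (y - PI / 2)) as [k [x [hx e]]].
  destruct hx as [[hx | <-] hx'].
  - exists (atan (t + tan x) + IZR k * PI).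
    assert (hat := atan_bound (t + tan x)).
    rewrite lift_shift_IZR, lift_base by lra.
    rewrite tan_atan. replace (t - (t + tan x)) with (- tan x) by ring.
    rewrite atan_opp, atan_tan by lra. lra.
  - exists (- (PI / 2) + IZR k * PI).
    rewrite lift_shift_IZR, lift_mPI2. lra.
Qed.

(** An increasing surjection is continuous: [psi] is trapped between the preimages of
    [lift t phi - eps] and [lift t phi + eps]. *)
Lemma lift_continuous (t phi eps : R) :
  0 < eps ->
  exists d : R, 0 < d /\
    forall psi, Rabs (psi - phi) < d -> Rabs (lift t psi - lift t phi) < eps.
Proof.
  intros he.
  destruct (lift_surjective t (lift t phi - eps)) as [a ha].
  destruct (lift_surjective t (lift t phi + eps)) as [b hb].
  assert (hmon : forall x y, lift t x < lift t y -> x < y).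
  { intros x y h. destruct (Rlt_le_dec x y) as [h' | h']; [ exact h' | ].
    apply (lift_le t) in h'; lra. }
  assert (a < phi) by (apply hmon; lra).
  assert (phi < b) by (apply hmon; lra).
  exists (Rmin (phi - a) (b - phi)); split; [ apply Rmin_pos; lra | ].
  intros psi h.
  assert (h1 := Rmin_l (phi - a) (b - phi)). assert (h2 := Rmin_r (phi - a) (b - phi)).
  apply Rabs_def2 in h.
  assert (lift t a < lift t psi) by (apply lift_increasing; lra).
  assert (lift t psi < lift t b) by (apply lift_increasing; lra).
  apply Rabs_def1; lra.
Qed.

(** * Variation of constants *)

Fixpoint vec (t : nat -> R) (v : R * R) (k : nat) : R * R :=
  match k with
  | O => v
  | S j => sl2_step (t j) (vec t v j)
  end.

Fixpoint ang (t : nat -> R) (phi : R) (k : nat) : R :=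
  match k with
  | O => phi
  | S j => lift (t j) (ang t phi j)
  end.

Lemma vec_is_angle (t : nat -> R) (v : R * R) (phi : R) (k : nat) :
  is_angle v phi -> is_angle (vec t v k) (ang t phi k).
Proof. intros h; induction k; cbn; [ exact h | now apply lift_is_angle ]. Qed.

Lemma ang_shift_IZR (t : nat -> R) (k : nat) (z : Z) (phi : R) :
  ang t (phi + IZR z * PI) k = ang t phi k + IZR z * PI.
Proof. induction k as [ | k IH]; cbn; [ ring | now rewrite IH, lift_shift_IZR ]. Qed.

Lemma ang_shift_INR (t : nat -> R) (k i : nat) (phi : R) :
  ang t (phi + INR i * PI) k = ang t phi k + INR i * PI.
Proof. rewrite INR_IZR_INZ; apply ang_shift_IZR. Qed.

Lemma ang_le (t : nat -> R) (k : nat) (phi psi : R) :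
  phi <= psi -> ang t phi k <= ang t psi k.
Proof. intros h; induction k; cbn; [ exact h | now apply lift_le ]. Qed.

Lemma ang_increasing (t : nat -> R) (k : nat) (phi psi : R) :
  phi < psi -> ang t phi k < ang t psi k.
Proof. intros h; induction k; cbn; [ exact h | now apply lift_increasing ]. Qed.

Lemma ang_antitone (t t' : nat -> R) (phi : R) (k : nat) :
  (forall j, t' j <= t j) -> ang t phi k <= ang t' phi k.
Proof.
  intros h; induction k as [ | k IH]; cbn; [ lra | ].
  apply (Rle_trans _ (lift (t k) (ang t' phi k))); [ now apply lift_le | ].
  now apply lift_window.
Qed.

Lemma ang_add (t : nat -> R) (phi : R) (k l : nat) :
  ang t phi (k + l) = ang (fun j => t (k + j)%nat) (ang t phi k) l.
Proof.
  induction l as [ | l IH]; [ now rewrite Nat.add_0_r | ].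
  rewrite Nat.add_succ_r; cbn; now rewrite IH.
Qed.

(* First row of the k-step transfer matrix; its second row is row t (k - 1). *)
Definition row (t : nat -> R) (k : nat) : R * R :=
  (fst (vec t (1, 0) k), fst (vec t (0, 1) k)).

Lemma vec_linear (t : nat -> R) (a b : R) (k : nat) :
  vec t (a, b) k
  = (a * fst (vec t (1, 0) k) + b * fst (vec t (0, 1) k),
     a * snd (vec t (1, 0) k) + b * snd (vec t (0, 1) k)).
Proof.
  induction k as [ | k IH]; cbn; [ f_equal; ring | ].
  rewrite IH; unfold sl2_step; cbn; f_equal; ring.
Qed.

Lemma vec_det (t : nat -> R) (k : nat) :
  fst (vec t (1, 0) k) * snd (vec t (0, 1) k)
  - fst (vec t (0, 1) k) * snd (vec t (1, 0) k) = 1.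
Proof.
  induction k as [ | k IH]; cbn; [ ring | ].
  unfold sl2_step; cbn; lra.
Qed.

Definition dot (c c' : R * R) : R := fst c * fst c' + snd c * snd c'.
Definition det (c c' : R * R) : R := fst c * snd c' - snd c * fst c'.

(** With [r] the first row of A_k, this is the inverse of A_(k+1) times the step with coefficient
    [t k - tau] times A_k. As r is also the second row of A_(k+1), the inverse of A_(k+1) sends the
    first basis vector to [(snd r, - fst r)]. The result is a shear along the kernel of [r]. *)
Definition kick (tau : R) (r c : R * R) : R * R :=
  (fst c - tau * dot r c * snd r, snd c + tau * dot r c * fst r).

(* Variation of constants: with A_k the transfer matrices of t, the solution of
   the recursion with coefficients t - tau is A_k c_k, and c_k always rotates
   counterclockwise. *)
Fixpoint coord (t : nat -> R) (tau : R) (v : R * R) (k : nat) : R * R :=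
  match k with
  | O => v
  | S j => kick tau (row t j) (coord t tau v j)
  end.

Lemma vec_coord (t : nat -> R) (tau : R) (v : R * R) (k : nat) :
  vec (fun j => t j - tau) v k = vec t (coord t tau v k) k.
Proof.
  induction k as [ | k IH]; [ reflexivity | ].
  cbn [vec]. rewrite IH. cbn [coord].
  set (c := coord t tau v k).
  rewrite (surjective_pairing (kick tau (row t k) c)).
  rewrite (vec_linear t (fst (kick _ _ _)) (snd (kick _ _ _))).
  replace (vec t c k) with (vec t (fst c, snd c) k) by now rewrite <- surjective_pairing.
  rewrite (vec_linear t (fst c) (snd c)); unfold kick.
  unfold dot, row; cbn [fst snd].
  assert (hd := vec_det t k).
  set (p := fst (vec t (1, 0) k)) in *; set (s := fst (vec t (0, 1) k)) in *.
  set (p' := snd (vec t (1, 0) k)) in *; set (s' := snd (vec t (0, 1) k)) in *.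
  unfold sl2_step; cbn [fst snd]; f_equal; [ | ring ].
  set (q := p * fst c + s * snd c).
  replace (fst c * p + snd c * s) with q by (unfold q; ring).
  (* The determinant is inserted as a factor 1 on the [tau] term, after which both sides are the
     same polynomial. *)
  transitivity (t k * q - (fst c * p' + snd c * s') - tau * q * (p * s' - s * p')).
  - rewrite hd; ring.
  - unfold q; ring.
Qed.

(** A lift of the angle of [coord]. The increment by [atan] is the true one as long as each kick
    turns by less than a quarter turn, that is, as long as [dot c c'] stays positive. *)
Fixpoint gam (t : nat -> R) (tau : R) (v : R * R) (phi : R) (k : nat) : R :=
  match k with
  | O => phi
  | S j =>
      let c := coord t tau v j in
      let c' := coord t tau v (S j) in
      gam t tau v phi j + atan (det c c' / dot c c')
  end.

Lemma is_angle_atan (c c' : R * R) (phi : R) :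
  is_angle c phi -> 0 < dot c c' -> is_angle c' (phi + atan (det c c' / dot c c')).
Proof.
  intros [r [hr ->]]; destruct c' as [a b]; unfold dot, det; cbn [fst snd]; intros h.
  set (p := r * cos phi * a + r * sin phi * b) in *.
  set (s := r * cos phi * b - r * sin phi * a).
  assert (hat := atan_bound (s / p)).
  assert (hc : 0 < cos (atan (s / p))) by (apply cos_gt_0; lra).
  assert (ht := tan_atan (s / p)); unfold tan in ht.
  set (d := atan (s / p)) in *.
  assert (hs : sin d = s / p * cos d) by (rewrite <- ht; field; lra).
  assert (h1 := sin2_cos2 phi); unfold Rsqr in h1.
  exists (p / (r * cos d)); split; [ apply Rdiv_lt_0_compat; nra | ].
  rewrite cos_plus, sin_plus, hs; f_equal.
  - replace (p / (r * cos d) * (cos phi * cos d - sin phi * (s / p * cos d)))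
      with ((p * cos phi - s * sin phi) / r) by (field; repeat split; lra).
    replace (p * cos phi - s * sin phi)
      with (r * a * (sin phi * sin phi + cos phi * cos phi)) by (unfold p, s; ring).
    rewrite h1; field; lra.
  - replace (p / (r * cos d) * (sin phi * cos d + cos phi * (s / p * cos d)))
      with ((p * sin phi + s * cos phi) / r) by (field; repeat split; lra).
    replace (p * sin phi + s * cos phi)
      with (r * b * (sin phi * sin phi + cos phi * cos phi)) by (unfold p, s; ring).
    rewrite h1; field; lra.
Qed.

(** * Norm and angle under a single kick *)

Lemma dot_pos (c : R * R) : 0 <= dot c c.
Proof. unfold dot; nra. Qed.

Lemma dot_det (r c : R * R) : dot r c ^ 2 + det r c ^ 2 = dot r r * dot c c.
Proof. unfold dot, det; ring. Qed.

Lemma det_kick (tau : R) (r c : R * R) : det c (kick tau r c) = tau * dot r c ^ 2.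
Proof. unfold det, kick, dot; cbn; ring. Qed.

(** The kick changes [dot c c] by [tau * (dot r c * det r c)]. By the Lagrange identity [dot_det]
    the product is at most [D * dot c c / 2] in absolute value, so the change is at most a quarter
    of [dot c c]. *)
Lemma dot_kick_bounds (tau D : R) (r c : R * R) :
  0 <= tau -> dot r r <= D -> tau * D <= / 2 ->
  dot c c / 2 <= dot c (kick tau r c) <= 2 * dot c c.
Proof.
  intros htau hD hs.
  assert (e : dot c (kick tau r c) = dot c c + tau * (dot r c * det r c))
    by (unfold dot, kick, det, dot; cbn; ring).
  assert (hn := dot_pos c). assert (hr := dot_pos r). assert (h := dot_det r c).
  rewrite e; clear e.
  set (n := dot c c) in *; set (p := dot r c) in *; set (q := det r c) in *.
  assert (h2 : p ^ 2 + q ^ 2 <= D * n) by (rewrite h; apply Rmult_le_compat_r; lra).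
  assert (h3 : - (D * n / 2) <= p * q <= D * n / 2).
  { assert (0 <= (p + q) ^ 2) by apply pow2_ge_0. assert (0 <= (p - q) ^ 2) by apply pow2_ge_0.
    split; nra. }
  set (w := p * q) in *.
  assert (tau * D * n <= / 2 * n) by nra.
  assert (tau * w <= tau * (D * n / 2)) by nra.
  assert (tau * (- (D * n / 2)) <= tau * w) by nra.
  lra.
Qed.

Lemma kick_norm (tau D : R) (r c : R * R) :
  0 <= tau -> dot r r <= D -> tau * D <= / 2 ->
  dot (kick tau r c) (kick tau r c) <= 4 * dot c c.
Proof.
  intros htau hD hs.
  assert (e : dot (kick tau r c) (kick tau r c)
              = 2 * dot c (kick tau r c) - dot c c + (tau * dot r c) ^ 2 * dot r r)
    by (unfold dot, kick, dot; cbn; ring).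
  destruct (dot_kick_bounds tau D r c htau hD hs) as [_ h1].
  assert (hn := dot_pos c). assert (hr := dot_pos r). assert (h := dot_det r c).
  rewrite e; clear e.
  set (n := dot c c) in *; set (p := dot r c) in *.
  assert (hp : p ^ 2 <= D * n).
  { assert (0 <= det r c ^ 2) by apply pow2_ge_0.
    assert (dot r r * n <= D * n) by (apply Rmult_le_compat_r; lra). lra. }
  assert ((tau * p) ^ 2 * dot r r <= n).
  { apply (Rle_trans _ ((tau * p) ^ 2 * D)); [ apply Rmult_le_compat_l; nra | ].
    replace ((tau * p) ^ 2 * D) with (tau ^ 2 * D * p ^ 2) by ring.
    apply (Rle_trans _ (tau ^ 2 * D * (D * n))).
    - apply Rmult_le_compat_l; nra.
    - replace (tau ^ 2 * D * (D * n)) with ((tau * D) ^ 2 * n) by ring.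
      assert (0 <= tau * D) by nra. assert ((tau * D) ^ 2 <= 1) by nra. nra. }
  lra.
Qed.

(** The tangent of the turning angle is [tau * dot r c ^ 2 / dot c (kick tau r c)]: a square in the
    numerator, hence counterclockwise motion. The lower bound degenerates when [c] is orthogonal to
    [r], so one kick alone guarantees no gain. *)
Lemma kick_angle (tau D : R) (r c : R * R) :
  0 <= tau -> dot r r <= D -> tau * D <= / 2 -> 0 < dot c c ->
  tau * dot r c ^ 2 / (4 * dot c c)
  <= atan (det c (kick tau r c) / dot c (kick tau r c)) <= 2 * tau * D.
Proof.
  intros htau hD hs hn.
  rewrite det_kick. destruct (dot_kick_bounds tau D r c htau hD hs) as [h1 h2].
  assert (hr := dot_pos r). assert (h := dot_det r c).
  set (n := dot c c) in *. set (dt := dot c (kick tau r c)) in *. set (q := dot r c) in *.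
  assert (h3 : q ^ 2 <= D * n).
  { assert (0 <= det r c ^ 2) by apply pow2_ge_0.
    assert (dot r r * n <= D * n) by (apply Rmult_le_compat_r; lra). lra. }
  assert (hq0 : 0 <= tau * q ^ 2) by nra.
  assert (hlow : tau * q ^ 2 / (2 * n) <= tau * q ^ 2 / dt).
  { apply Rmult_le_compat_l; [ exact hq0 | apply Rinv_le_contravar; lra ]. }
  assert (hup : tau * q ^ 2 / dt <= 2 * tau * D).
  { apply (Rmult_le_reg_r dt); [ lra | ].
    replace (tau * q ^ 2 / dt * dt) with (tau * q ^ 2) by (field; lra).
    assert (0 <= tau * D) by nra.
    assert (tau * q ^ 2 <= tau * (D * n)) by nra. nra. }
  assert (h0 : 0 <= tau * q ^ 2 / dt)
    by (apply Rmult_le_pos; [ exact hq0 | apply Rlt_le, Rinv_0_lt_compat; lra ]).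
  split.
  - apply (Rle_trans _ (tau * q ^ 2 / dt / 2)).
    + replace (tau * q ^ 2 / (4 * n)) with (tau * q ^ 2 / (2 * n) / 2) by (field; lra). lra.
    + apply atan_ge_half; lra.
  - assert (h4 := atan_diff_le 0 (tau * q ^ 2 / dt) h0). rewrite atan_0 in h4. lra.
Qed.

Lemma is_angle_dot_pos (c : R * R) (phi : R) : is_angle c phi -> 0 < dot c c.
Proof.
  intros h; apply is_angle_neq0 in h.
  destruct (dot_pos c) as [h' | h']; [ exact h' | ].
  elim h; rewrite (surjective_pairing c). unfold dot in h'. f_equal; nra.
Qed.

Lemma gam_is_angle (t : nat -> R) (tau D : R) (v : R * R) (phi : R) (K : nat) :
  0 <= tau -> (forall k, (k < K)%nat -> dot (row t k) (row t k) <= D) -> tau * D <= / 2 ->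
  is_angle v phi -> forall k, (k <= K)%nat -> is_angle (coord t tau v k) (gam t tau v phi k).
Proof.
  intros htau hD hs hv k; induction k as [ | k IH]; intros hk; [ exact hv | ].
  specialize (IH ltac:(lia)). cbn [gam]. apply is_angle_atan; [ exact IH | ].
  cbn [coord].
  assert (h := dot_kick_bounds tau D (row t k) (coord t tau v k) htau (hD k ltac:(lia)) hs).
  assert (h' := is_angle_dot_pos _ _ IH). lra.
Qed.

Lemma gam_step (t : nat -> R) (tau D : R) (v : R * R) (phi : R) (K : nat) :
  0 <= tau -> (forall k, (k < K)%nat -> dot (row t k) (row t k) <= D) -> tau * D <= / 2 ->
  is_angle v phi -> forall k, (k < K)%nat ->
  let c := coord t tau v k in
  tau * dot (row t k) c ^ 2 / (4 * dot c c)
  <= gam t tau v phi (S k) - gam t tau v phi k <= 2 * tau * D.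
Proof.
  intros htau hD hs hv k hk c.
  assert (hc : is_angle c (gam t tau v phi k)).
  { apply (gam_is_angle t tau D v phi K); auto; lia. }
  assert (h := kick_angle tau D (row t k) c htau (hD k hk) hs (is_angle_dot_pos _ _ hc)).
  cbn [gam coord]; fold c; lra.
Qed.

(** Both sides are angles of one vector by [vec_coord]. The branches stay together because, measured
    from [lift (t k) (ang t g k)], one candidate is less than [PI] ahead since the kick turns by at
    most 1, and the other is less than [PI] ahead by [lift_window]. *)
Lemma ang_gam (t : nat -> R) (tau D : R) (v : R * R) (phi : R) (K : nat) :
  0 <= tau -> (forall k, (k < K)%nat -> dot (row t k) (row t k) <= D) -> tau * D <= / 2 ->
  is_angle v phi -> forall k, (k <= K)%nat ->
  ang (fun j => t j - tau) phi k = ang t (gam t tau v phi k) k.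
Proof.
  intros htau hD hs hv k; induction k as [ | k IH]; intros hk; [ reflexivity | ].
  specialize (IH ltac:(lia)).
  assert (hpi := PI_RGT_0). assert (hpi2 := PI2_1).
  assert (hst := gam_step t tau D v phi K htau hD hs hv k hk). cbv zeta in hst.
  assert (h0 : 0 <= tau * dot (row t k) (coord t tau v k) ^ 2
                    / (4 * dot (coord t tau v k) (coord t tau v k))).
  { apply Rmult_le_pos; [ nra | ]. apply Rlt_le, Rinv_0_lt_compat.
    assert (0 < dot (coord t tau v k) (coord t tau v k)); [ | lra ].
    eapply is_angle_dot_pos, (gam_is_angle t tau D v phi K); auto; lia. }
  set (g := gam t tau v phi k) in *.
  set (g' := gam t tau v phi (S k)) in *.
  assert (h1 : ang t g k <= ang t g' k) by (apply ang_le; lra).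
  assert (h2 : ang t g' k < ang t g k + PI).
  { replace (ang t g k + PI) with (ang t (g + IZR 1 * PI) k)
      by (rewrite ang_shift_IZR; ring).
    apply ang_increasing; lra. }
  apply (lift_le (t k)) in h1. apply (lift_increasing (t k)) in h2.
  rewrite lift_shift in h2.
  assert (h3 := lift_window (t k) (t k - tau) (ang t g k) ltac:(lra)).
  apply (is_angle_unique (vec (fun j => t j - tau) v (S k))).
  - now apply vec_is_angle.
  - rewrite vec_coord. apply vec_is_angle.
    apply (gam_is_angle t tau D v phi K); auto.
  - cbn [ang]. rewrite IH. apply Rabs_def1; lra.
Qed.

(* A_(k+1) has determinant 1, so it shrinks no vector by more than its
   Hilbert-Schmidt norm; hence one of two consecutive kicks is effective. *)
Lemma gam_two_steps (t : nat -> R) (tau D : R) (v : R * R) (phi : R) (K : nat) :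
  0 <= tau -> (forall k, (k < K)%nat -> dot (row t k) (row t k) <= D) ->
  tau * D <= / 2 -> tau <= / 2 ->
  is_angle v phi -> forall k, (S k < K)%nat ->
  gam t tau v phi k + tau / (64 * D) <= gam t tau v phi (S (S k)).
Proof.
  intros htau hD hs ht2 hv k hk.
  assert (h1 := gam_step t tau D v phi K htau hD hs hv k ltac:(lia)).
  assert (h2 := gam_step t tau D v phi K htau hD hs hv (S k) hk).
  cbv zeta in h1, h2.
  assert (hc : 0 < dot (coord t tau v k) (coord t tau v k)).
  { eapply is_angle_dot_pos, (gam_is_angle t tau D v phi K); auto; lia. }
  assert (hc' : 0 < dot (coord t tau v (S k)) (coord t tau v (S k))).
  { eapply is_angle_dot_pos, (gam_is_angle t tau D v phi K); auto; lia. }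
  assert (hD1 := hD k ltac:(lia)). assert (hD2 := hD (S k) hk).
  assert (hdet : det (row t (S k)) (row t k) = 1).
  { assert (h := vec_det t k). unfold det, row; cbn [vec sl2_step fst snd]. lra. }
  set (c := coord t tau v k) in *.
  assert (hn := kick_norm tau D (row t k) c htau hD1 hs).
  cbn [coord] in h2, hc'; fold c in h2, hc'.
  (* Consecutive rows have determinant 1, so the second kick can be measured on the original [c]
     instead of the kicked one. *)
  assert (e : dot (row t (S k)) (kick tau (row t k) c)
              = dot (row t (S k)) c - tau * dot (row t k) c).
  { transitivity (dot (row t (S k)) c
                  - tau * dot (row t k) c * det (row t (S k)) (row t k)).
    - unfold dot, det, kick, dot; cbn [fst snd]; ring.
    - rewrite hdet; ring. }
  rewrite e in h2.
  set (n := dot c c) in *. set (n' := dot (kick _ _ _) (kick _ _ _)) in *.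
  set (r := row t k) in *; set (r' := row t (S k)) in *.
  (* Cramer's rule recovers [c] from its products with two rows of determinant 1; these products
     cannot both be small. *)
  assert (hlow : n <= 2 * D * (dot r' c ^ 2 + dot r c ^ 2)).
  { assert (hid : n * (det r' r) ^ 2
              = (dot r' c * snd r - dot r c * snd r') ^ 2
                + (dot r c * fst r' - dot r' c * fst r) ^ 2)
      by (unfold n, det, dot; ring).
    rewrite hdet in hid.
    assert (hp := dot_pos r). assert (hp' := dot_pos r').
    set (x := dot r' c) in *; set (y := dot r c) in *.
    assert (hexp : (x * snd r - y * snd r') ^ 2 + (y * fst r' - x * fst r) ^ 2
                   <= (x ^ 2 + y ^ 2) * (dot r r + dot r' r')).
    { unfold dot.
      assert (0 <= (x * fst r' + y * fst r) ^ 2) by apply pow2_ge_0.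
      assert (0 <= (x * snd r' + y * snd r) ^ 2) by apply pow2_ge_0. lra. }
    assert (0 <= x ^ 2 + y ^ 2) by (apply Rplus_le_le_0_compat; apply pow2_ge_0).
    assert ((x ^ 2 + y ^ 2) * (dot r r + dot r' r') <= (x ^ 2 + y ^ 2) * (2 * D))
      by (apply Rmult_le_compat_l; lra).
    rewrite pow1, Rmult_1_r in hid. lra. }
  set (x := dot r' c) in *; set (y := dot r c) in *.
  assert (hDpos : 0 < D).
  { assert (0 <= x ^ 2 + y ^ 2) by (apply Rplus_le_le_0_compat; apply pow2_ge_0).
    destruct (Rle_lt_dec D 0) as [hd | hd]; [ | exact hd ].
    assert (D * (x ^ 2 + y ^ 2) <= 0 * (x ^ 2 + y ^ 2)) by (apply Rmult_le_compat_r; lra).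
    lra. }
  assert (hxy : x ^ 2 + y ^ 2 <= 2 * ((x - tau * y) ^ 2 + y ^ 2)).
  { assert (0 <= (x - 2 * tau * y) ^ 2) by apply pow2_ge_0.
    assert (0 <= y ^ 2) by apply pow2_ge_0.
    assert (tau ^ 2 <= / 4) by (clear - htau ht2; nra).
    assert (tau ^ 2 * y ^ 2 <= / 4 * y ^ 2) by (apply Rmult_le_compat_r; lra). lra. }
  assert (g1 : tau * y ^ 2 / (16 * n) <= tau * y ^ 2 / (4 * n)).
  { apply Rmult_le_compat_l; [ apply Rmult_le_pos; [ lra | apply pow2_ge_0 ] | ]. apply Rinv_le_contravar; lra. }
  assert (g2 : tau * (x - tau * y) ^ 2 / (16 * n) <= tau * (x - tau * y) ^ 2 / (4 * n')).
  { apply Rmult_le_compat_l; [ apply Rmult_le_pos; [ lra | apply pow2_ge_0 ] | ]. apply Rinv_le_contravar; lra. }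
  (* [hlow] and [hxy] give [n <= 4 * D * ((x - tau * y) ^ 2 + y ^ 2)]. The factor 16 comes from the
     4 of [kick_angle] and the 4 of [kick_norm], whence 64. *)
  assert (g3 : tau / (64 * D) <= tau * y ^ 2 / (16 * n) + tau * (x - tau * y) ^ 2 / (16 * n)).
  { replace (tau * y ^ 2 / (16 * n) + tau * (x - tau * y) ^ 2 / (16 * n))
      with (tau * (((x - tau * y) ^ 2 + y ^ 2) / (16 * n))) by (field; lra).
    unfold Rdiv at 1. apply Rmult_le_compat_l; [ exact htau | ].
    apply (Rmult_le_reg_r (64 * D * n)); [ apply Rmult_lt_0_compat; lra | ].
    replace (/ (64 * D) * (64 * D * n)) with n by (field; lra).
    replace (((x - tau * y) ^ 2 + y ^ 2) / (16 * n) * (64 * D * n))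
      with (4 * D * ((x - tau * y) ^ 2 + y ^ 2)) by (field; lra).
    apply (Rle_trans _ _ _ hlow).
    apply (Rmult_le_compat_l (2 * D)) in hxy; lra. }
  lra.
Qed.

(** * Rotation numbers *)

Lemma ang_gain (t : nat -> R) (tau D phi : R) (j : nat) :
  0 <= tau -> (forall k, (k < 2 * j)%nat -> dot (row t k) (row t k) <= D) ->
  tau * D <= / 2 -> tau <= / 2 -> PI <= INR j * (tau / (64 * D)) ->
  ang t phi (2 * j) + PI <= ang (fun k => t k - tau) phi (2 * j).
Proof.
  intros htau hD hs ht2 hj.
  set (v := (cos phi, sin phi)).
  assert (hv : is_angle v phi) by apply is_angle_cos_sin.
  rewrite (ang_gam t tau D v phi (2 * j)) by auto.
  assert (hg : forall i, (i <= j)%nat ->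
            phi + INR i * (tau / (64 * D)) <= gam t tau v phi (2 * i)).
  { induction i as [ | i IH]; intros hi; [ cbn; lra | ].
    specialize (IH ltac:(lia)).
    assert (h := gam_two_steps t tau D v phi (2 * j) htau hD hs ht2 hv (2 * i) ltac:(lia)).
    replace (2 * S i)%nat with (S (S (2 * i))) by lia.
    rewrite S_INR; lra. }
  specialize (hg j (le_n _)).
  replace (ang t phi (2 * j) + PI) with (ang t (phi + IZR 1 * PI) (2 * j))
    by (rewrite ang_shift_IZR; ring).
  apply ang_le; lra.
Qed.

Lemma ang_cap (t : nat -> R) (tau D phi : R) (k : nat) :
  0 <= tau -> (forall j, (j < k)%nat -> dot (row t j) (row t j) <= D) ->
  tau * D <= / 2 -> INR k * (2 * tau * D) <= PI ->
  ang (fun j => t j - tau) phi k <= ang t phi k + PI.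
Proof.
  intros htau hD hs hk.
  set (v := (cos phi, sin phi)).
  assert (hv : is_angle v phi) by apply is_angle_cos_sin.
  rewrite (ang_gam t tau D v phi k) by auto.
  assert (hg : forall i, (i <= k)%nat -> gam t tau v phi i <= phi + INR i * (2 * tau * D)).
  { induction i as [ | i IH]; intros hi; [ cbn; lra | ].
    specialize (IH ltac:(lia)).
    assert (h := gam_step t tau D v phi k htau hD hs hv i ltac:(lia)). cbv zeta in h.
    rewrite S_INR; lra. }
  specialize (hg k (le_n _)).
  replace (ang t phi k + PI) with (ang t (phi + IZR 1 * PI) k)
    by (rewrite ang_shift_IZR; ring).
  apply ang_le; lra.
Qed.

Definition tail (t : nat -> R) (k : nat) : nat -> R := fun j => t (k + j)%nat.

(** Earlier gains pass through a block as exact multiples of [PI]. The incomplete last block gains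
    nothing but, since [t' <= t], loses nothing either. *)
Lemma ang_blocks_ge (t t' : nat -> R) (L : nat) :
  (forall k, t' k <= t k) ->
  (forall k phi, ang (tail t k) phi L + PI <= ang (tail t' k) phi L) ->
  forall i r phi, ang t phi (i * L + r) + INR i * PI <= ang t' phi (i * L + r).
Proof.
  intros ht hg i r phi.
  assert (h : ang t phi (i * L) + INR i * PI <= ang t' phi (i * L)).
  { induction i as [ | i IH]; [ cbn; lra | ].
    replace (S i * L)%nat with (i * L + L)%nat by lia.
    rewrite !ang_add. fold (tail t (i * L)) (tail t' (i * L)).
    apply (ang_le (tail t' (i * L)) L) in IH. rewrite ang_shift_INR in IH.
    specialize (hg (i * L)%nat (ang t phi (i * L))).
    rewrite S_INR; lra. }
  rewrite !ang_add. fold (tail t (i * L)) (tail t' (i * L)).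
  apply (ang_le (tail t' (i * L)) r) in h. rewrite ang_shift_INR in h.
  assert (h2 := ang_antitone (tail t (i * L)) (tail t' (i * L)) (ang t phi (i * L)) r
                  (fun j => ht (i * L + j)%nat)).
  lra.
Qed.

Lemma ang_blocks_le (t t' : nat -> R) (L : nat) :
  (forall k phi r, (r <= L)%nat -> ang (tail t' k) phi r <= ang (tail t k) phi r + PI) ->
  forall i r phi, (r <= L)%nat ->
    ang t' phi (i * L + r) <= ang t phi (i * L + r) + (INR i + 1) * PI.
Proof.
  intros hg i r phi hr.
  (* Allowing [r = L] makes this serve twice: as the induction step over full blocks and for the
     remainder, which costs the extra [PI]. *)
  assert (hst : forall i r, (r <= L)%nat ->
            ang t' phi (i * L) <= ang t phi (i * L) + INR i * PI ->
            ang t' phi (i * L + r) <= ang t phi (i * L + r) + (INR i + 1) * PI).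
  { clear i r hr; intros i r hr IH.
    rewrite !ang_add. fold (tail t (i * L)) (tail t' (i * L)).
    apply (ang_le (tail t' (i * L)) r) in IH. rewrite ang_shift_INR in IH.
    specialize (hg (i * L)%nat (ang t phi (i * L)) r hr). lra. }
  apply hst; [ exact hr | ]. clear r hr.
  induction i as [ | i IH]; [ cbn; lra | ].
  replace (S i * L)%nat with (i * L + L)%nat by lia.
  rewrite S_INR. apply hst; [ lia | exact IH ].
Qed.

Lemma ang_ext (t t' : nat -> R) (phi : R) (k : nat) :
  (forall j, t j = t' j) -> ang t phi k = ang t' phi k.
Proof. intros h; induction k as [ | k IH]; cbn; [ reflexivity | now rewrite IH, h ]. Qed.

Lemma ang_bound (t : nat -> R) (k : nat) : Rabs (ang t 0 k) <= 2 * PI * INR k.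
Proof.
  assert (hpi := PI_RGT_0).
  induction k as [ | k IH]; [ cbn; rewrite Rabs_R0; lra | ].
  cbn [ang]. assert (h := lift_bounds (t k) (ang t 0 k)).
  apply Rabs_le_between in IH. rewrite S_INR. apply Rabs_le; lra.
Qed.

(** * Limits of averaged angles *)

Lemma Lim_seq_bounded (u : nat -> R) (B : R) :
  (forall n, Rabs (u n) <= B) ->
  exists ls li : R, is_LimSup_seq u (Finite ls) /\ is_LimInf_seq u (Finite li) /\
    Lim_seq u = Finite ((ls + li) / 2).
Proof.
  intros hB.
  assert (hle : forall n, u n <= B) by (intros n; apply (proj1 (Rabs_le_between _ _) (hB n))).
  assert (hge : forall n, - B <= u n) by (intros n; apply (proj1 (Rabs_le_between _ _) (hB n))).
  assert (hs : is_LimSup_seq u (LimSup_seq u)) by apply (proj2_sig (ex_LimSup_seq u)).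
  assert (hi : is_LimInf_seq u (LimInf_seq u)) by apply (proj2_sig (ex_LimInf_seq u)).
  assert (h1 : Rbar_le (LimSup_seq u) B).
  { rewrite <- (LimSup_seq_const B). apply LimSup_le. now exists O. }
  assert (h2 : Rbar_le (- B) (LimInf_seq u)).
  { rewrite <- (LimInf_seq_const (- B)). apply LimInf_le. now exists O. }
  assert (h3 := LimSup_LimInf_seq_le u).
  destruct (LimSup_seq u) as [ls | | ] eqn:es, (LimInf_seq u) as [li | | ] eqn:ei;
    cbn in h1, h2, h3; try contradiction.
  exists ls, li; split; [ exact hs | split; [ exact hi | ] ].
  unfold Lim_seq. now rewrite es, ei.
Qed.

Lemma is_LimSup_seq_shift (u : nat -> R) (l c : R) :
  is_LimSup_seq u (Finite l) -> is_LimSup_seq (fun n => u n + c) (Finite (l + c)).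
Proof.
  intros h eps; destruct (h eps) as [h1 [N h2]]; split.
  - intros M; destruct (h1 M) as [n [hn hu]]; exists n; split; [ exact hn | lra ].
  - exists N; intros n hn; specialize (h2 n hn); lra.
Qed.

Lemma is_LimInf_seq_shift (u : nat -> R) (l c : R) :
  is_LimInf_seq u (Finite l) -> is_LimInf_seq (fun n => u n + c) (Finite (l + c)).
Proof.
  intros h eps; destruct (h eps) as [h1 [N h2]]; split.
  - intros M; destruct (h1 M) as [n [hn hu]]; exists n; split; [ exact hn | lra ].
  - exists N; intros n hn; specialize (h2 n hn); lra.
Qed.

Lemma real_Lim_seq_le (u v : nat -> R) (B c : R) :
  (forall n, Rabs (u n) <= B) -> (forall n, Rabs (v n) <= B) ->
  eventually (fun n => u n <= v n + c) ->
  real (Lim_seq u) <= real (Lim_seq v) + c.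
Proof.
  intros hu hv h.
  destruct (Lim_seq_bounded u B hu) as [ls [li [_ [_ e1]]]].
  destruct (Lim_seq_bounded v B hv) as [ls' [li' [h1 [h2 e2]]]].
  apply Lim_seq_le_loc in h. rewrite e1 in h.
  unfold Lim_seq in h.
  rewrite (is_LimSup_seq_unique _ _ (is_LimSup_seq_shift v ls' c h1)) in h.
  rewrite (is_LimInf_seq_unique _ _ (is_LimInf_seq_shift v li' c h2)) in h.
  rewrite e1, e2. cbn in h |- *. lra.
Qed.

Definition avg_rot (V : nat -> R) (E : R) (n : nat) : R :=
  ang (fun k => E - V k) 0 (S n) / (2 * PI * INR (S n)).

(* Rotation number of the recursion x_(k+1) = (E - V k) x_k - x_(k-1). *)
Definition rot (V : nat -> R) (E : R) : R := real (Lim_seq (avg_rot V E)).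

Lemma avg_rot_bound (V : nat -> R) (E : R) (n : nat) : Rabs (avg_rot V E n) <= 1.
Proof.
  assert (hpi := PI_RGT_0). assert (hn := lt_0_INR (S n) ltac:(lia)).
  unfold avg_rot. unfold Rdiv; rewrite Rabs_mult.
  assert (hp : 0 < 2 * PI * INR (S n)) by nra.
  rewrite (Rabs_pos_eq (/ _)) by (apply Rlt_le, Rinv_0_lt_compat, hp).
  apply (Rmult_le_reg_r (2 * PI * INR (S n))); [ exact hp | ].
  rewrite Rmult_assoc, Rinv_l by lra.
  assert (h := ang_bound (fun k => E - V k) (S n)). lra.
Qed.

(** The slack [eps] absorbs whatever is of lower order than the number of steps, such as bounded
    angle differences and incomplete blocks. *)
Lemma rot_le_of_ang (V : nat -> R) (E E' c : R) :
  (forall eps, 0 < eps -> eventually (fun n =>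
     ang (fun k => E - V k) 0 (S n)
     <= ang (fun k => E' - V k) 0 (S n) + (c + eps) * (2 * PI * INR (S n)))) ->
  rot V E <= rot V E' + c.
Proof.
  intros h. apply le_epsilon; intros eps he.
  rewrite Rplus_assoc. apply (real_Lim_seq_le _ _ 1).
  - apply avg_rot_bound.
  - apply avg_rot_bound.
  - destruct (h eps he) as [N hN]. exists N; intros n hn; specialize (hN n hn).
    assert (hpi := PI_RGT_0). assert (hn' := lt_0_INR (S n) ltac:(lia)).
    unfold avg_rot. set (q := 2 * PI * INR (S n)) in *.
    assert (hq : 0 < q) by (unfold q; nra).
    apply (Rmult_le_reg_r q); [ exact hq | ].
    replace (ang (fun k => E - V k) 0 (S n) / q * q) with (ang (fun k => E - V k) 0 (S n))
      by (field; lra).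
    replace ((ang (fun k => E' - V k) 0 (S n) / q + (c + eps)) * q)
      with (ang (fun k => E' - V k) 0 (S n) + (c + eps) * q) by (field; lra).
    exact hN.
Qed.

Lemma eventually_const_le (C eps : R) : 0 < eps -> eventually (fun n => C <= eps * INR (S n)).
Proof.
  intros he.
  destruct (INR_archimed eps C he) as [N hN].
  exists N; intros n hn.
  assert (INR N <= INR (S n)) by (apply le_INR; lia). nra.
Qed.

Lemma rot_le_of_ang_const (V : nat -> R) (E E' C : R) :
  (forall n, ang (fun k => E - V k) 0 n <= ang (fun k => E' - V k) 0 n + C) ->
  rot V E <= rot V E'.
Proof.
  intros h. rewrite <- (Rplus_0_r (rot V E')). apply rot_le_of_ang; intros eps he.
  assert (hpi := PI_RGT_0).
  destruct (eventually_const_le C (eps * (2 * PI)) ltac:(nra)) as [N hN].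
  exists N; intros n hn; specialize (hN n hn); specialize (h (S n)).
  rewrite Rplus_0_l. lra.
Qed.

Lemma rot_antitone (V : nat -> R) (E E' : R) : E <= E' -> rot V E' <= rot V E.
Proof.
  intros h. apply (rot_le_of_ang_const V E' E 0); intros n.
  rewrite Rplus_0_r. apply ang_antitone; intros j; lra.
Qed.

Lemma rot_gain (V : nat -> R) (E tau D : R) (j : nat) :
  0 <= tau -> (0 < j)%nat ->
  (forall l k, (k < 2 * j)%nat ->
     dot (row (fun i => E - V (l + i)%nat) k) (row (fun i => E - V (l + i)%nat) k) <= D) ->
  tau * D <= / 2 -> tau <= / 2 -> PI <= INR j * (tau / (64 * D)) ->
  rot V E < rot V (E - tau).
Proof.
  intros htau hj0 hD hs ht2 hj.
  assert (hpi := PI_RGT_0).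
  set (L := (2 * j)%nat).
  assert (hL : 0 < INR L) by (apply lt_0_INR; unfold L; lia).
  assert (hc : 0 < / (4 * INR L)) by (apply Rinv_0_lt_compat; lra).
  (* Half a turn per [L] steps is a rate of [/ (2 * INR L)]; half of this rate is given up to pay
     for the incomplete last block. *)
  enough (rot V E <= rot V (E - tau) + - / (4 * INR L)) by lra.
  apply rot_le_of_ang; intros eps he.
  destruct (eventually_const_le PI (PI / (2 * INR L)) ltac:(apply Rdiv_lt_0_compat; lra))
    as [N hN].
  exists N; intros n hn; specialize (hN n hn).
  assert (hb := ang_blocks_ge (fun k => E - V k) (fun k => E - tau - V k) L).
  specialize (hb ltac:(intros; lra)).
  assert (hyp : forall k phi, ang (tail (fun k => E - V k) k) phi L + PI
                  <= ang (tail (fun k => E - tau - V k) k) phi L).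
  { intros k phi. unfold tail.
    rewrite (ang_ext (fun i => E - tau - V (k + i)%nat) (fun i => E - V (k + i)%nat - tau))
      by (intros; ring).
    apply (ang_gain (fun i => E - V (k + i)%nat) tau D phi j); auto. }
  specialize (hb hyp (S n / L)%nat (S n mod L)%nat 0).
  replace (S n / L * L + S n mod L)%nat with (S n) in hb
    by (rewrite (Nat.div_mod_eq (S n) L) at 1; lia).
  assert (hi : INR (S n) <= (INR (S n / L) + 1) * INR L).
  { rewrite <- S_INR, <- mult_INR. apply le_INR.
    assert (h := Nat.mod_upper_bound (S n) L ltac:(unfold L; lia)).
    assert (h' := Nat.div_mod_eq (S n) L). nia. }
  set (x := INR (S n)) in *. set (y := INR (S n / L)) in *.
  assert (hx : 0 < x) by (unfold x; apply lt_0_INR; lia).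
  assert (e : - / (4 * INR L) * (2 * PI * x) = - (PI / (2 * INR L) * x)) by (field; lra).
  assert (h1 : x / INR L <= y + 1).
  { apply (Rmult_le_reg_r (INR L)); [ lra | ].
    replace (x / INR L * INR L) with x by (field; lra). exact hi. }
  assert (h2 : PI / (2 * INR L) * x = PI * (x / INR L) / 2) by (field; lra).
  assert (0 <= eps * (2 * PI * x)) by (apply Rmult_le_pos; nra).
  rewrite Rmult_plus_distr_r, e. nra.
Qed.

Lemma row_bound (t : nat -> R) (B : R) (k : nat) :
  0 <= B -> (forall j, Rabs (t j) <= B) ->
  dot (row t k) (row t k) <= 2 * (1 + B) ^ (2 * k).
Proof.
  intros hB ht.
  assert (h : forall v, Rabs (fst v) <= 1 -> Rabs (snd v) <= 1 ->
            Rabs (fst (vec t v k)) <= (1 + B) ^ k /\ Rabs (snd (vec t v k)) <= (1 + B) ^ k).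
  { intros v h1 h2; induction k as [ | k IH]; cbn [vec pow]; [ lra | ].
    destruct IH as [i1 i2]. specialize (ht k).
    set (w := vec t v k) in *. set (m := (1 + B) ^ k) in *.
    assert (0 <= m) by (apply pow_le; lra).
    unfold sl2_step; cbn [fst snd]; split; [ | nra ].
    eapply Rle_trans; [ apply Rabs_triang | ].
    rewrite Rabs_Ropp, Rabs_mult.
    assert (Rabs (t k) * Rabs (fst w) <= B * m)
      by (apply Rmult_le_compat; auto using Rabs_pos). lra. }
  destruct (h (1, 0)) as [h1 _]; [ cbn; rewrite Rabs_R1; lra | cbn; rewrite Rabs_R0; lra | ].
  destruct (h (0, 1)) as [h2 _]; [ cbn; rewrite Rabs_R0; lra | cbn; rewrite Rabs_R1; lra | ].
  unfold dot, row; cbn [fst snd].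
  replace (2 * k)%nat with (k + k)%nat by lia. rewrite pow_add.
  apply Rabs_le_between in h1. apply Rabs_le_between in h2. nra.
Qed.

(** A gain of at most half a turn per block is a rate of [/ (2 * INR L)], and the incomplete block
    at most doubles it once a full block has passed. The a priori growth [row_bound] is enough here,
    as [tau] may be tiny depending on [L]. *)
Lemma rot_cap (V : nat -> R) (B E tau : R) (L : nat) :
  0 <= B -> (forall k, Rabs (E - V k) <= B) -> 0 <= tau -> (0 < L)%nat ->
  INR L * (2 * tau * (2 * (1 + B) ^ (2 * L))) <= / 2 ->
  rot V (E - tau) <= rot V E + / INR L.
Proof.
  intros hB hV htau hL hsm.
  assert (hpi := PI_RGT_0). assert (hpi2 := PI2_1).
  set (D := 2 * (1 + B) ^ (2 * L)) in *.
  assert (hL1 : 1 <= INR L) by (apply (le_INR 1); lia).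
  assert (hDp : 0 <= tau * D).
  { apply Rmult_le_pos; [ lra | ]. unfold D. apply Rmult_le_pos; [ lra | apply pow_le; lra ]. }
  apply rot_le_of_ang; intros eps he.
  exists L; intros n hn.
  assert (hyp : forall k phi r, (r <= L)%nat ->
            ang (tail (fun k => E - tau - V k) k) phi r
            <= ang (tail (fun k => E - V k) k) phi r + PI).
  { intros k phi r hr. unfold tail.
    rewrite (ang_ext (fun i => E - tau - V (k + i)%nat) (fun i => E - V (k + i)%nat - tau))
      by (intros; ring).
    apply (ang_cap (fun i => E - V (k + i)%nat) tau D phi r).
    - exact htau.
    - intros j hj. eapply Rle_trans; [ apply (row_bound _ B); auto | ].
      unfold D. apply Rmult_le_compat_l; [ lra | ]. apply Rle_pow; [ lra | lia ].
    - nra.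
    - assert (INR r <= INR L) by (apply le_INR, hr). assert (0 <= INR r) by apply pos_INR. nra. }
  assert (hm := Nat.mod_upper_bound (S n) L ltac:(lia)).
  assert (hb := ang_blocks_le (fun k => E - V k) (fun k => E - tau - V k) L hyp
                  (S n / L) (S n mod L) 0 ltac:(lia)).
  replace (S n / L * L + S n mod L)%nat with (S n) in hb
    by (rewrite (Nat.div_mod_eq (S n) L) at 1; lia).
  assert (hi : INR (S n / L) * INR L <= INR (S n)).
  { rewrite <- mult_INR. apply le_INR.
    assert (h' := Nat.div_mod_eq (S n) L). nia. }
  assert (hi2 : INR L <= INR (S n)) by (apply le_INR; lia).
  set (x := INR (S n)) in *. set (y := INR (S n / L)) in *.
  assert (h1 : y <= x / INR L).
  { apply (Rmult_le_reg_r (INR L)); [ lra | ].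
    replace (x / INR L * INR L) with x by (field; lra). exact hi. }
  assert (h2 : 1 <= x / INR L).
  { apply (Rmult_le_reg_r (INR L)); [ lra | ].
    replace (x / INR L * INR L) with x by (field; lra). lra. }
  assert (0 <= eps * (2 * PI * x)) by (apply Rmult_le_pos; nra).
  replace ((/ INR L + eps) * (2 * PI * x)) with (2 * PI * (x / INR L) + eps * (2 * PI * x))
    by (field; lra).
  nra.
Qed.

Lemma rot_continuous (V : nat -> R) (B : R) :
  (forall k, Rabs (V k) <= B) ->
  forall E eps, 0 < eps -> exists d, 0 < d /\
    forall E', Rabs (E' - E) < d -> Rabs (rot V E' - rot V E) <= eps.
Proof.
  intros hV E eps he.
  assert (hB : 0 <= B) by (eapply Rle_trans; [ apply Rabs_pos | apply (hV O) ]).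
  destruct (INR_archimed eps 1 he) as [L hL].
  assert (hL0 : 0 < INR L) by (assert (h := pos_INR L); nra).
  assert (hL' : (0 < L)%nat) by (apply INR_lt; exact hL0).
  assert (hLe : / INR L <= eps).
  { apply (Rmult_le_reg_r (INR L)); [ exact hL0 | ]. rewrite Rinv_l; lra. }
  set (B' := B + Rabs E + 1).
  assert (hB' : 0 <= B') by (unfold B'; assert (h := Rabs_pos E); lra).
  set (D := 2 * (1 + B') ^ (2 * L)).
  assert (hD : 0 < D) by (unfold D; apply Rmult_lt_0_compat; [ lra | apply pow_lt; lra ]).
  set (d := / (4 * INR L * D)).
  assert (hd : 0 < d) by (apply Rinv_0_lt_compat; nra).
  (* Uniform in the base point [E0]: for [E'] above [E] the energy is lowered from [E'], not from
     [E]. *)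
  assert (key : forall E0 tau, 0 <= tau < d -> Rabs E0 <= Rabs E + 1 ->
            rot V (E0 - tau) <= rot V E0 + eps).
  { intros E0 tau ht hE0.
    eapply Rle_trans; [ apply (rot_cap V B' E0 tau L) | lra ]; auto; try lra.
    - intros k. eapply Rle_trans; [ apply Rabs_triang | ]. rewrite Rabs_Ropp.
      specialize (hV k). unfold B'; lra.
    - fold D. assert (e : INR L * (2 * d * D) = / 2) by (unfold d; field; split; lra).
      rewrite <- e. apply Rmult_le_compat_l; [ lra | ]. nra. }
  exists (Rmin d 1); split; [ apply Rmin_pos; lra | ].
  intros E' h.
  assert (h1 := Rmin_l d 1). assert (h2 := Rmin_r d 1).
  assert (hE' : Rabs E' <= Rabs E + 1).
  { replace E' with (E' - E + E) by ring.
    eapply Rle_trans; [ apply Rabs_triang | ]. lra. }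
  apply Rabs_def2 in h.
  destruct (Rle_dec E' E) as [hle | hle].
  - assert (k := key E (E - E') ltac:(lra) ltac:(lra)).
    replace (E - (E - E')) with E' in k by ring.
    assert (k' := rot_antitone V _ _ hle). apply Rabs_le; lra.
  - assert (k := key E' (E' - E) ltac:(lra) hE').
    replace (E' - (E' - E)) with E in k by ring.
    assert (k' := rot_antitone V E E' ltac:(lra)). apply Rabs_le; lra.
Qed.

(** * Rotation number at extreme energies *)

Lemma lift_0 (t : R) : lift t 0 = PI / 2 - atan t.
Proof.
  assert (h := PI_RGT_0). rewrite lift_base by lra. now rewrite tan_0, Rminus_0_r.
Qed.

Lemma atan_ge_PI4 (x : R) : 1 <= x -> PI / 4 <= atan x.
Proof.
  intros [h | <-]; [ | rewrite atan_1; lra ].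
  rewrite <- atan_1. now apply Rlt_le, atan_increasing.
Qed.

(** For [t >= 2] the cone of angles between 0 and [PI / 4] is mapped into itself, so the angle stays
    bounded. *)
Lemma rot_right (V : nat -> R) (E : R) : (forall k, 2 <= E - V k) -> rot V E = 0.
Proof.
  intros h. assert (hpi := PI_RGT_0).
  assert (hang : forall k, 0 <= ang (fun j => E - V j) 0 k <= PI / 4).
  { induction k as [ | k IH]; [ cbn; lra | ]. cbn [ang].
    set (a := ang _ 0 k) in *. specialize (h k). set (t := E - V k) in *.
    assert (h0 := lift_le t 0 a ltac:(lra)). assert (h1 := lift_le t a (PI / 4) ltac:(lra)).
    rewrite lift_0 in h0. rewrite (lift_base t (PI / 4)), tan_PI4 in h1 by lra.
    assert (h2 := atan_ge_PI4 (t - 1) ltac:(lra)). assert (h3 := atan_bound t). lra. }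
  unfold rot. rewrite (is_lim_seq_unique _ (Finite 0)); [ reflexivity | ].
  apply (is_lim_seq_le_le (fun _ => 0) _ (fun n => 1 / INR (S n))).
  - intros n. specialize (hang (S n)). unfold avg_rot.
    assert (hn := lt_0_INR (S n) ltac:(lia)).
    split.
    + apply Rmult_le_pos; [ lra | apply Rlt_le, Rinv_0_lt_compat; nra ].
    + apply (Rmult_le_reg_r (2 * PI * INR (S n))); [ nra | ].
      unfold Rdiv at 1. rewrite Rmult_assoc, Rinv_l by nra.
      replace (1 / INR (S n) * (2 * PI * INR (S n))) with (2 * PI) by (field; lra). lra.
  - apply is_lim_seq_const.
  - apply (is_lim_seq_incr_1 (fun n => 1 / INR n)).
    apply (is_lim_seq_ext (fun n => / INR n)); [ intros; unfold Rdiv; ring | ].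
    apply (is_lim_seq_inv INR p_infty); [ apply is_lim_seq_INR | discriminate ].
Qed.

(** For [t <= -2] the cone of angles between [- (PI / 4)] and 0 is mapped into itself advanced by
    [PI]: every step makes half a turn up to a bounded error. *)
Lemma rot_left (V : nat -> R) (E : R) : (forall k, E - V k <= - 2) -> rot V E = / 2.
Proof.
  intros h. assert (hpi := PI_RGT_0).
  assert (hang : forall k, INR k * PI - PI / 4 <= ang (fun j => E - V j) 0 k <= INR k * PI).
  { induction k as [ | k IH]; [ cbn; lra | ]. cbn [ang]. rewrite S_INR.
    set (a := ang _ 0 k) in *. specialize (h k). set (t := E - V k) in *.
    assert (h0 := lift_le t a (0 + INR k * PI) ltac:(lra)).
    assert (h1 := lift_le t (- (PI / 4) + INR k * PI) a ltac:(lra)).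
    rewrite INR_IZR_INZ in h0, h1. rewrite lift_shift_IZR in h0, h1.
    rewrite <- INR_IZR_INZ in h0, h1.
    rewrite lift_0 in h0. rewrite (lift_base t (- (PI / 4))), tan_neg, tan_PI4 in h1 by lra.
    assert (h2 := atan_ge_PI4 (- (t - - (1))) ltac:(lra)). rewrite atan_opp in h2.
    assert (h3 := atan_bound t). lra. }
  unfold rot. rewrite (is_lim_seq_unique _ (Finite (/ 2))); [ reflexivity | ].
  apply (is_lim_seq_le_le (fun n => / 2 - 1 / INR (S n)) _ (fun _ => / 2)).
  - intros n. specialize (hang (S n)). unfold avg_rot.
    assert (hn := lt_0_INR (S n) ltac:(lia)).
    assert (hp : 0 < 2 * PI * INR (S n)) by nra.
    split; apply (Rmult_le_reg_r (2 * PI * INR (S n))); try exact hp;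
      unfold Rdiv at 1; rewrite ?(Rmult_assoc (ang _ _ _)), ?Rinv_l by lra.
    + replace ((/ 2 - 1 * / INR (S n)) * (2 * PI * INR (S n)))
        with (INR (S n) * PI - 2 * PI) by (field; lra).
      unfold Rdiv; rewrite (Rmult_assoc (ang _ _ _)), Rinv_l by lra. lra.
    + lra.
  - replace (Finite (/ 2)) with (Finite (/ 2 - 0)) by (f_equal; ring).
    apply is_lim_seq_minus'; [ apply is_lim_seq_const | ].
    apply (is_lim_seq_incr_1 (fun n => 1 / INR n)).
    apply (is_lim_seq_ext (fun n => / INR n)); [ intros; unfold Rdiv; ring | ].
    apply (is_lim_seq_inv INR p_infty); [ apply is_lim_seq_INR | discriminate ].
  - apply is_lim_seq_const.
Qed.

(** * Box eigenvectors and the spectrum *)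

Lemma ang_continuity (V : nat -> R) (N : nat) :
  continuity (fun E => ang (fun k => E - V k) 0 N).
Proof.
  intros E; induction N as [ | N IH].
  - apply continuity_pt_const. intros x y; reflexivity.
  - apply continuity_pt_locally; intros [eps he]; cbn [pos].
    set (phi := ang (fun k => E - V k) 0 N) in *.
    destruct (lift_continuous (E - V N) phi (eps / 2) ltac:(lra)) as [d [hd hl]].
    destruct (proj1 (continuity_pt_locally _ _) IH (mkposreal d hd)) as [d1 h1].
    assert (hd1 := cond_pos d1).
    assert (hd2 : 0 < Rmin d1 (eps / 2)) by (apply Rmin_pos; lra).
    exists (mkposreal _ hd2); intros E' hE'. cbn in hE'.
    assert (m1 := Rmin_l d1 (eps / 2)). assert (m2 := Rmin_r d1 (eps / 2)).
    assert (hb : Rabs (E' - E) < Rmin d1 (eps / 2)) by exact hE'.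
    assert (hN : Rabs (ang (fun k => E' - V k) 0 N - phi) < d).
    { apply h1. change (Rabs (E' - E) < d1). lra. }
    cbn [ang]. fold phi. set (psi := ang (fun k => E' - V k) 0 N) in *.
    specialize (hl psi hN).
    assert (h2 := lift_lipschitz (E' - V N) (E - V N) psi).
    replace (E' - V N - (E - V N)) with (E' - E) in h2 by ring.
    replace (lift (E' - V N) psi - lift (E - V N) phi)
      with (lift (E' - V N) psi - lift (E - V N) psi
            + (lift (E - V N) psi - lift (E - V N) phi)) by ring.
    eapply Rle_lt_trans; [ apply Rabs_triang | ]. lra.
Qed.

(** The start [(1, 0)] encodes the Dirichlet condition at site -1, so [sol V E (S M) = 0] says that
    [E] is an eigenvalue of the box from 0 to [M]. *)
Definition sol (V : nat -> R) (E : R) (n : nat) : R :=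
  fst (vec (fun k => E - V k) (1, 0) n).

Lemma sol_0 (V : nat -> R) (E : R) : sol V E 0 = 1.
Proof. reflexivity. Qed.

Lemma sol_1 (V : nat -> R) (E : R) : sol V E 1 = (E - V O) * sol V E 0.
Proof. unfold sol; cbn; ring. Qed.

Lemma sol_SS (V : nat -> R) (E : R) (n : nat) :
  sol V E (S (S n)) = (E - V (S n)) * sol V E (S n) - sol V E n.
Proof. reflexivity. Qed.

Lemma sol_orthogonal (V : nat -> R) (E E' : R) (M : nat) :
  sol V E (S M) = 0 -> sol V E' (S M) = 0 -> E <> E' ->
  sum_n (fun n => sol V E n * sol V E' n) M = 0.
Proof.
  intros h h' hne.
  (* The discrete Green formula; the right side is a Wronskian and vanishes under the Dirichlet
     condition. *)
  assert (hw : forall n, (E - E') * sum_n (fun n => sol V E n * sol V E' n) n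
             = sol V E (S n) * sol V E' n - sol V E n * sol V E' (S n)).
  { induction n as [ | n IH].
    - rewrite sum_O, !sol_1. ring.
    - rewrite sum_Sn, !sol_SS. change plus with Rplus.
      rewrite Rmult_plus_distr_l, IH. ring. }
  specialize (hw M). rewrite h, h' in hw.
  apply (Rmult_eq_reg_l (E - E')); lra.
Qed.

Lemma sum_n_square3 (a b c : nat -> R) (x y z : R) (M : nat) :
  (sum_n (fun n => (x * a n + y * b n + z * c n) ^ 2) M : R)
  = x ^ 2 * sum_n (fun n => a n ^ 2) M + y ^ 2 * sum_n (fun n => b n ^ 2) M
    + z ^ 2 * sum_n (fun n => c n ^ 2) M
    + 2 * (x * y * sum_n (fun n => a n * b n) M + x * z * sum_n (fun n => a n * c n) M
           + y * z * sum_n (fun n => b n * c n) M).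
Proof.
  induction M as [ | M IH]; [ rewrite !sum_O; ring | ].
  rewrite !sum_Sn, IH. change plus with Rplus. ring.
Qed.

(** Up to sign, the second witness is the cross product of [(1, 1, 1)] and [(z1, z2, z3)]. The two
    equations make a combination of box eigenvectors vanish at sites 0, where each equals 1, and
    [M]. *)
Lemma exists_combination (z1 z2 z3 : R) :
  exists a1 a2 a3 : R,
    a1 + a2 + a3 = 0 /\ a1 * z1 + a2 * z2 + a3 * z3 = 0 /\
    0 < a1 ^ 2 + a2 ^ 2 + a3 ^ 2.
Proof.
  destruct (Req_dec z1 z2) as [<- | h].
  - exists 1, (- 1), 0; repeat split; lra.
  - exists (z2 - z3), (z3 - z1), (z1 - z2); repeat split; try ring.
    assert (0 < (z1 - z2) ^ 2) by (apply pow2_gt_0; lra).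
    assert (h1 := pow2_ge_0 (z2 - z3)). assert (h2 := pow2_ge_0 (z3 - z1)). lra.
Qed.

(** * Finitely supported vectors and the resolvent *)

Definition embed (M : nat) (w : nat -> R) (z : Z) : C :=
  if (Z.leb 0 z && Z.leb z (Z.of_nat M))%bool then RtoC (w (Z.to_nat z)) else RtoC 0.

Lemma embed_in (M : nat) (w : nat -> R) (n : nat) :
  (n <= M)%nat -> embed M w (Z.of_nat n) = RtoC (w n).
Proof.
  intros h; unfold embed.
  rewrite (proj2 (Z.leb_le 0 _)), (proj2 (Z.leb_le _ (Z.of_nat M))) by lia.
  now rewrite Nat2Z.id.
Qed.

Lemma embed_out (M : nat) (w : nat -> R) (z : Z) :
  (z < 0 \/ Z.of_nat M < z)%Z -> embed M w z = RtoC 0.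
Proof.
  unfold embed; intros [h | h].
  - now rewrite (proj2 (Z.leb_gt 0 z)) by lia.
  - rewrite (proj2 (Z.leb_gt z _)) by lia. now rewrite Bool.andb_false_r.
Qed.

Lemma is_series_finite (a : nat -> R) (M : nat) :
  (forall n, (M < n)%nat -> a n = 0) -> is_series a (sum_n a M).
Proof.
  intros h. apply (proj1 (is_lim_seq_spec (sum_n a) (sum_n a M))).
  intros eps. exists M; intros n hn.
  assert (e : sum_n a n = sum_n a M).
  { induction hn as [ | n hn IH]; [ reflexivity | ].
    rewrite sum_Sn, IH, (h (S n)) by lia. change plus with Rplus. apply Rplus_0_r. }
  rewrite e, Rminus_eq_0, Rabs_R0. apply cond_pos.
Qed.

Lemma embed_pos_series (M : nat) (w : nat -> R) :
  is_series (fun j : nat => Cmod (embed M w (Z.of_nat j)) ^ 2) (sum_n (fun n => w n ^ 2) M).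
Proof.
  assert (e : sum_n (fun n => w n ^ 2) M
              = sum_n (fun j : nat => Cmod (embed M w (Z.of_nat j)) ^ 2) M).
  { apply sum_n_ext_loc; intros n hn.
    rewrite embed_in, Cmod_R by exact hn. now rewrite pow2_abs. }
  rewrite e. apply is_series_finite; intros n hn.
  rewrite embed_out by lia. rewrite Cmod_0. ring.
Qed.

Lemma embed_neg_series (M : nat) (w : nat -> R) :
  is_series (fun j : nat => Cmod (embed M w (- Z.of_nat (S j))%Z) ^ 2) 0.
Proof.
  assert (h0 : forall j, Cmod (embed M w (- Z.of_nat (S j))%Z) ^ 2 = 0).
  { intros j. rewrite embed_out by lia. rewrite Cmod_0. ring. }
  replace 0 with (sum_n (fun j => Cmod (embed M w (- Z.of_nat (S j))%Z) ^ 2) 0)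
    by now rewrite sum_O, h0.
  apply is_series_finite; intros n _; apply h0.
Qed.

Lemma embed_in_l2 (M : nat) (w : nat -> R) : in_l2 (embed M w).
Proof.
  split; eexists; [ apply embed_pos_series | apply embed_neg_series ].
Qed.

Lemma embed_l2_norm (M : nat) (w : nat -> R) :
  l2_norm (embed M w) = sqrt (sum_n (fun n => w n ^ 2) M).
Proof.
  unfold l2_norm.
  rewrite (is_series_unique _ _ (embed_pos_series M w)).
  rewrite (is_series_unique _ _ (embed_neg_series M w)). now rewrite Rplus_0_r.
Qed.

Lemma in_l2_ext (x y : Z -> C) : (forall z, x z = y z) -> in_l2 x -> in_l2 y.
Proof.
  intros h [h1 h2]; split; [ revert h1 | revert h2 ];
    apply ex_series_ext; intros n; now rewrite h.
Qed.

Lemma l2_norm_ext (x y : Z -> C) : (forall z, x z = y z) -> l2_norm x = l2_norm y.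
Proof.
  intros h; unfold l2_norm; f_equal; f_equal; apply Series_ext; intros n; now rewrite h.
Qed.

Lemma resolvent_lower_bound (T : (Z -> C) -> (Z -> C)) (z : C) :
  in_resolvent_set T z ->
  exists B : R, 0 < B /\ forall y y' : Z -> C, in_l2 y -> in_l2 y' ->
    (forall n, y' n = T y n - z * y n)%C -> l2_norm y <= B * l2_norm y'.
Proof.
  intros [G [B hG]]. exists (Rabs B + 1); split; [ assert (h := Rabs_pos B); lra | ].
  intros y y' hy hy' e.
  set (y2 := (fun k => T y k - z * y k)%C).
  assert (hy2 : in_l2 y2) by (apply (in_l2_ext y'); auto).
  destruct (hG y hy) as [_ [_ [_ h4]]]. destruct (hG y2 hy2) as [_ [h2 _]].
  rewrite (l2_norm_ext (G y2) y h4) in h2.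
  rewrite (l2_norm_ext y' y2 e).
  assert (h5 := Rle_abs B). assert (h6 : 0 <= l2_norm y2) by apply sqrt_pos. nra.
Qed.

Definition potential (lam : R) (f : C -> C) (alpha : R) (k : nat) : R :=
  lam * Re (f (RtoC (0 + INR k * alpha))).

(** Each zero of [w] settles one boundary site: [w O] the site -1, [w M] the site [S M], and
    [w (S M)] the site [M], where the recursion looks one site past the box. *)
Lemma schrodinger_embed (lam : R) (f : C -> C) (alpha E : R) (M : nat) (w h : nat -> R) :
  (forall x : R, Im (f (RtoC x)) = 0) ->
  w O = 0 -> w M = 0 -> w (S M) = 0 ->
  h O = w 1%nat - (E - potential lam f alpha 0) * w O ->
  (forall n, h (S n) = w (S (S n)) + w n - (E - potential lam f alpha (S n)) * w (S n)) ->
  forall z : Z, embed M h z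
    = (schrodinger lam f alpha 0 (embed M w) z - RtoC E * embed M w z)%C.
Proof.
  intros hf w0 wM wS h0 hS.
  assert (hpot : forall n : nat, (RtoC lam * f (RtoC (0 + IZR (Z.of_nat n) * alpha)))%C
            = RtoC (potential lam f alpha n)).
  { intros n. rewrite <- INR_IZR_INZ. unfold potential.
    specialize (hf (0 + INR n * alpha)).
    destruct (f (RtoC (0 + INR n * alpha))) as [a b]. cbn in hf |- *. subst b.
    unfold RtoC, Cmult; cbn; f_equal; ring. }
  intros z; unfold schrodinger.
  destruct (Z_lt_le_dec z 0) as [hz | hz].
  - rewrite !(embed_out M _ z) by lia. rewrite (embed_out M w (z - 1)) by lia.
    assert (e : embed M w (z + 1) = RtoC 0).
    { destruct (Z.eq_dec z (- 1)) as [-> | hz'].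
      - change (-1 + 1)%Z with (Z.of_nat 0). rewrite embed_in by lia. now rewrite w0.
      - apply embed_out; lia. }
    rewrite e; ring.
  - rewrite <- (Z2Nat.id z hz). set (n := Z.to_nat z).
    rewrite hpot.
    destruct (Nat.le_gt_cases n M) as [hn | hn].
    + rewrite !(embed_in M _ n) by exact hn.
      assert (e1 : embed M w (Z.of_nat n + 1) = RtoC (w (S n))).
      { replace (Z.of_nat n + 1)%Z with (Z.of_nat (S n)) by lia.
        destruct (Nat.eq_dec n M) as [-> | hnM].
        - rewrite embed_out by lia. now rewrite wS.
        - apply embed_in; lia. }
      rewrite e1. destruct n as [ | n].
      * rewrite (embed_out M w (Z.of_nat 0 - 1)) by lia. rewrite h0.
        rewrite <- !RtoC_mult, <- !RtoC_plus, <- RtoC_minus. f_equal. ring.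
      * replace (Z.of_nat (S n) - 1)%Z with (Z.of_nat n) by lia.
        rewrite embed_in by lia. rewrite hS.
        rewrite <- !RtoC_mult, <- !RtoC_plus, <- RtoC_minus. f_equal. ring.
    + rewrite !(embed_out M _ (Z.of_nat n)) by lia.
      rewrite (embed_out M w (Z.of_nat n + 1)) by lia.
      assert (e : embed M w (Z.of_nat n - 1) = RtoC 0).
      { destruct (Nat.eq_dec n (S M)) as [-> | hn'].
        - replace (Z.of_nat (S M) - 1)%Z with (Z.of_nat M) by lia.
          rewrite embed_in by lia. now rewrite wM.
        - apply embed_out; lia. }
      rewrite e; ring.
Qed.

Lemma sum_n_sq_sol_pos (V : nat -> R) (E : R) (M : nat) :
  0 < sum_n (fun n => sol V E n ^ 2) M.
Proof.
  induction M as [ | M IH].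
  - rewrite sum_O, sol_0; lra.
  - rewrite sum_Sn. change plus with Rplus. assert (h := pow2_ge_0 (sol V E (S M))). lra.
Qed.

(** Applying the operator minus [E] multiplies the three coefficients by [E1 - E], [E2 - E],
    [E3 - E]. By orthogonality the norm shrinks by the factor [eps], whatever the box and the size
    of the eigenvectors, while the resolvent allows no factor below [/ B]. *)
Lemma no_three_eigenvalues (lam : R) (f : C -> C) (alpha E : R) :
  (forall x : R, Im (f (RtoC x)) = 0) ->
  in_resolvent_set (schrodinger lam f alpha 0) (RtoC E) ->
  exists eps : R, 0 < eps /\
    forall (M : nat) (E1 E2 E3 : R),
      E1 <> E2 -> E1 <> E3 -> E2 <> E3 ->
      Rabs (E1 - E) <= eps -> Rabs (E2 - E) <= eps -> Rabs (E3 - E) <= eps ->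
      let V := potential lam f alpha in
      sol V E1 (S M) = 0 -> sol V E2 (S M) = 0 -> sol V E3 (S M) = 0 -> False.
Proof.
  intros hf hres.
  destruct (resolvent_lower_bound _ _ hres) as [B [hB hlow]].
  exists (/ (2 * B)); split; [ apply Rinv_0_lt_compat; lra | ].
  intros M E1 E2 E3 n12 n13 n23 d1 d2 d3 V s1 s2 s3.
  set (eps := / (2 * B)) in *.
  assert (heps : 0 < eps) by (apply Rinv_0_lt_compat; lra).
  assert (hBe : B * eps = / 2) by (unfold eps; field; lra).
  destruct (exists_combination (sol V E1 M) (sol V E2 M) (sol V E3 M))
    as [a1 [a2 [a3 [c1 [c2 c3]]]]].
  set (w := fun n => a1 * sol V E1 n + a2 * sol V E2 n + a3 * sol V E3 n).
  set (h := fun n => (a1 * (E1 - E)) * sol V E1 n + (a2 * (E2 - E)) * sol V E2 n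
                     + (a3 * (E3 - E)) * sol V E3 n).
  assert (hineq := hlow (embed M w) (embed M h) (embed_in_l2 _ _) (embed_in_l2 _ _)).
  assert (hop : forall z : Z, embed M h z
    = (schrodinger lam f alpha 0 (embed M w) z - RtoC E * embed M w z)%C).
  { apply schrodinger_embed; auto; unfold w, h; fold V.
    - rewrite !sol_0; lra.
    - rewrite s1, s2, s3; ring.
    - rewrite !sol_1, !sol_0; ring.
    - intros n. rewrite !sol_SS; ring. }
  specialize (hineq hop).
  rewrite !embed_l2_norm in hineq.
  assert (eW : (sum_n (fun n => w n ^ 2) M : R)
     = a1 ^ 2 * sum_n (fun n => sol V E1 n ^ 2) M + a2 ^ 2 * sum_n (fun n => sol V E2 n ^ 2) M
       + a3 ^ 2 * sum_n (fun n => sol V E3 n ^ 2) M).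
  { unfold w. rewrite sum_n_square3.
    rewrite (sol_orthogonal V E1 E2), (sol_orthogonal V E1 E3), (sol_orthogonal V E2 E3)
      by auto. ring. }
  assert (eH : (sum_n (fun n => h n ^ 2) M : R)
     = (a1 * (E1 - E)) ^ 2 * sum_n (fun n => sol V E1 n ^ 2) M
       + (a2 * (E2 - E)) ^ 2 * sum_n (fun n => sol V E2 n ^ 2) M
       + (a3 * (E3 - E)) ^ 2 * sum_n (fun n => sol V E3 n ^ 2) M).
  { unfold h. rewrite sum_n_square3.
    rewrite (sol_orthogonal V E1 E2), (sol_orthogonal V E1 E3), (sol_orthogonal V E2 E3)
      by auto. ring. }
  assert (p1 := sum_n_sq_sol_pos V E1 M). assert (p2 := sum_n_sq_sol_pos V E2 M).
  assert (p3 := sum_n_sq_sol_pos V E3 M).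
  set (W := sum_n (fun n => w n ^ 2) M) in *. set (H := sum_n (fun n => h n ^ 2) M) in *.
  set (S1 := sum_n (fun n => sol V E1 n ^ 2) M) in *.
  set (S2 := sum_n (fun n => sol V E2 n ^ 2) M) in *.
  set (S3 := sum_n (fun n => sol V E3 n ^ 2) M) in *.
  assert (q1 := pow2_ge_0 a1). assert (q2 := pow2_ge_0 a2). assert (q3 := pow2_ge_0 a3).
  assert (hW : 0 < W).
  (* The coefficients are not all zero but it is unknown which, so all three norms are bounded below
     by their minimum. *)
  { rewrite eW. set (mn := Rmin S1 (Rmin S2 S3)).
    assert (hm : 0 < mn) by (repeat apply Rmin_pos; lra).
    assert (m1 : mn <= S1) by apply Rmin_l.
    assert (m2 : mn <= S2) by (eapply Rle_trans; [ apply Rmin_r | apply Rmin_l ]).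
    assert (m3 : mn <= S3) by (eapply Rle_trans; [ apply Rmin_r | apply Rmin_r ]).
    apply (Rmult_le_compat_l _ _ _ q1) in m1. apply (Rmult_le_compat_l _ _ _ q2) in m2.
    apply (Rmult_le_compat_l _ _ _ q3) in m3.
    assert (0 < (a1 ^ 2 + a2 ^ 2 + a3 ^ 2) * mn) by (apply Rmult_lt_0_compat; lra). lra. }
  assert (hsq : forall a x s, Rabs x <= eps -> 0 < s ->
            (a * x) ^ 2 * s <= eps ^ 2 * (a ^ 2 * s)).
  { intros a x s hx hs. apply Rabs_le_between in hx.
    assert (x ^ 2 <= eps ^ 2) by nra.
    assert (0 <= a ^ 2 * s) by (apply Rmult_le_pos; [ apply pow2_ge_0 | lra ]).
    replace ((a * x) ^ 2 * s) with (x ^ 2 * (a ^ 2 * s)) by ring.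
    apply Rmult_le_compat_r; lra. }
  assert (hH : H <= eps ^ 2 * W).
  { rewrite eH, eW.
    assert (g1 := hsq a1 (E1 - E) S1 d1 p1). assert (g2 := hsq a2 (E2 - E) S2 d2 p2).
    assert (g3 := hsq a3 (E3 - E) S3 d3 p3). lra. }
  apply sqrt_le_1_alt in hH.
  rewrite sqrt_mult_alt, sqrt_pow2 in hH by nra.
  assert (hsW : 0 < sqrt W) by (apply sqrt_lt_R0; lra).
  assert (B * sqrt H <= B * (eps * sqrt W)) by (apply Rmult_le_compat_l; lra).
  rewrite <- Rmult_assoc, hBe in H0. lra.
Qed.

Lemma resolvent_ang_bound (lam : R) (f : C -> C) (alpha E : R) :
  (forall x : R, Im (f (RtoC x)) = 0) ->
  in_resolvent_set (schrodinger lam f alpha 0) (RtoC E) ->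
  let V := potential lam f alpha in
  exists eps : R, 0 < eps /\ forall N : nat,
    ang (fun k => E - eps - V k) 0 N <= ang (fun k => E + eps - V k) 0 N + 4 * PI.
Proof.
  intros hf hres V.
  destruct (no_three_eigenvalues lam f alpha E hf hres) as [eps [he h3]].
  exists eps; split; [ exact he | ]. intros N.
  assert (hpi := PI_RGT_0).
  destruct N as [ | M]; [ cbn; lra | ].
  destruct (Rle_lt_dec (ang (fun k => E - eps - V k) 0 (S M))
              (ang (fun k => E + eps - V k) 0 (S M) + 4 * PI)) as [hle | hgt];
    [ exact hle | exfalso ].
  set (F := fun e => ang (fun k => e - V k) 0 (S M)).
  assert (hFc : continuity F) by apply ang_continuity.
  change (F (E + eps) + 4 * PI < F (E - eps)) in hgt.
  destruct (angle_decomp (F (E + eps))) as [k [x [hx ek]]].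
  (* The first component vanishes at the angles [PI / 2] modulo [PI]. The three such levels from
     [PI / 2 + IZR k * PI] upward lie within [3 * PI] above [F (E + eps)], hence below
     [F (E - eps)]. *)
  assert (hzero : forall i : Z, (0 <= i <= 2)%Z ->
    exists e, Rabs (e - E) <= eps /\ F e = PI / 2 + IZR (k + i) * PI /\
              sol V e (S M) = 0).
  { intros i hi.
    assert (hi1 : 0 <= IZR i <= 2) by (split; apply IZR_le; lia).
    destruct (IVT_gen F (E - eps) (E + eps) (PI / 2 + IZR (k + i) * PI) hFc)
      as [e [hb hv]].
    { rewrite Rmin_right, Rmax_left by lra. rewrite plus_IZR. split; nra. }
    rewrite Rmin_left, Rmax_right in hb by lra.
    exists e; split; [ apply Rabs_le; lra | split; [ exact hv | ] ].
    destruct (vec_is_angle (fun k => e - V k) (1, 0) 0 (S M)) as [r [hr hvec]].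
    { exists 1; split; [ lra | ]. rewrite cos_0, sin_0. f_equal; ring. }
    unfold sol. rewrite hvec. cbn [fst].
    change (r * cos (F e) = 0). rewrite hv.
    assert (hc : forall z : Z, cos (PI / 2 + IZR z * PI) = 0).
    { intros z. rewrite cos_plus, cos_PI2, sin_PI2.
      rewrite (sin_eq_0_1 (IZR z * PI)) by now exists z. ring. }
    rewrite hc; ring. }
  destruct (hzero 0%Z ltac:(lia)) as [e0 [b0 [v0 z0]]].
  destruct (hzero 1%Z ltac:(lia)) as [e1 [b1 [v1 z1]]].
  destruct (hzero 2%Z ltac:(lia)) as [e2 [b2 [v2 z2]]].
  rewrite plus_IZR in v0, v1, v2.
  apply (h3 M e0 e1 e2); auto; intros ->; lra.
Qed.

(** * Transfer matrices and gap edges *)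

(** The turns telescope along the lifted angle, which starts at 0 for [(1, 0)]. A [sum_n] up to [n]
    has [S n] terms, hence the index in [avg_rot]. *)
Lemma rho_rot (lam : R) (f : C -> C) (alpha E : R) :
  rho lam f alpha E = rot (potential lam f alpha) E.
Proof.
  assert (hpi := PI_RGT_0).
  set (V := potential lam f alpha).
  assert (hdir : forall k, direction lam f alpha E 0 (1, 0) k
                           = vec (fun j => E - V j) (1, 0) k).
  { induction k as [ | k IH]; [ reflexivity | ]. cbn. now rewrite IH. }
  assert (h10 : is_angle (1, 0) 0).
  { exists 1; split; [ lra | ]. rewrite cos_0, sin_0. f_equal; ring. }
  assert (hturn : forall k, turn (vec (fun j => E - V j) (1, 0) k)
                              (vec (fun j => E - V j) (1, 0) (S k))
    = (ang (fun j => E - V j) 0 (S k) - ang (fun j => E - V j) 0 k) / (2 * PI)).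
  { intros k. cbn [vec ang].
    rewrite <- (turn_lift (E - V k) _ _ (vec_is_angle (fun j => E - V j) (1, 0) 0 k h10)).
    field; lra. }
  unfold rho, rot; f_equal; apply Lim_seq_ext; intros n.
  assert (hn := lt_0_INR (S n) ltac:(lia)).
  assert (hs : (sum_n (fun k => turn (direction lam f alpha E 0 (1, 0) k)
                          (direction lam f alpha E 0 (1, 0) (S k))) n : R)
               = ang (fun j => E - V j) 0 (S n) / (2 * PI)).
  { induction n as [ | n IH].
    - rewrite sum_O, !hdir, hturn. cbn [ang]. field; lra.
    - rewrite sum_Sn, IH by (apply lt_0_INR; lia). rewrite !hdir, hturn.
      change plus with Rplus. field; lra. }
  rewrite hs; unfold avg_rot; field; lra.
Qed.

Lemma sampling_continuity (delta : R) (f : C -> C) :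
  0 <= delta -> real_analytic_on_strip delta f ->
  continuity (fun x : R => Re (f (RtoC x))).
Proof.
  intros hd [_ [_ ha]] x.
  assert (hz : strip delta (RtoC x)) by (unfold strip; cbn; rewrite Rabs_R0; exact hd).
  apply ha, locally_singleton, ex_derive_continuous in hz.
  apply continuity_pt_locally; intros eps.
  destruct (hz (fun w => Rabs (Re w - Re (f (RtoC x))) < eps)) as [d hd'].
  - exists eps; intros y [hy _]. exact hy.
  - exists d; intros y hy. apply hd'. change (Cmod (RtoC y - RtoC x) < d).
    rewrite <- RtoC_minus, Cmod_R. exact hy.
Qed.

Lemma periodic_bounded (g : R -> R) :
  continuity g -> (forall x, g (x + 1) = g x) -> exists B, forall x, Rabs (g x) <= B.
Proof.
  intros hc hp.
  assert (hn : forall n x, g (x + INR n) = g x).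
  { induction n as [ | n IH]; intros x; [ cbn; now rewrite Rplus_0_r | ].
    rewrite S_INR, <- Rplus_assoc, hp; apply IH. }
  destruct (continuity_ab_maj g 0 1 ltac:(lra) (fun c _ => hc c)) as [M [hM _]].
  destruct (continuity_ab_min g 0 1 ltac:(lra) (fun c _ => hc c)) as [m [hm _]].
  exists (Rabs (g M) + Rabs (g m)).
  assert (h01 : forall x, 0 <= x <= 1 -> Rabs (g x) <= Rabs (g M) + Rabs (g m)).
  { intros x hx. specialize (hM x hx). specialize (hm x hx).
    assert (h1 := Rle_abs (g M)). assert (h2 := Rle_abs (- g m)). rewrite Rabs_Ropp in h2.
    assert (h3 := Rabs_pos (g M)). assert (h4 := Rabs_pos (g m)).
    apply Rabs_le; lra. }
  intros x. destruct (archimed x) as [a1 a2].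
  set (k := (up x - 1)%Z).
  assert (hk : IZR k = IZR (up x) - 1) by (unfold k; apply minus_IZR).
  assert (e : g x = g (x - IZR k)).
  { destruct (Z_le_gt_dec 0 k) as [h | h].
    - rewrite <- (hn (Z.to_nat k) (x - IZR k)).
      rewrite INR_IZR_INZ, Z2Nat.id by lia. f_equal; ring.
    - rewrite <- (hn (Z.to_nat (- k)) x).
      rewrite INR_IZR_INZ, Z2Nat.id by lia. rewrite opp_IZR. f_equal. }
  rewrite e. apply h01. lra.
Qed.

Lemma potential_bounded (delta lam : R) (f : C -> C) (alpha : R) :
  0 <= delta -> real_analytic_on_strip delta f ->
  exists B, forall k, Rabs (potential lam f alpha k) <= B.
Proof.
  intros hd hf.
  destruct (periodic_bounded _ (sampling_continuity delta f hd hf)) as [B hB].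
  { intros x. rewrite RtoC_plus. destruct hf as [hp _].
    rewrite hp; [ reflexivity | ]. unfold strip; cbn; rewrite Rabs_R0; exact hd. }
  exists (Rabs lam * B); intros k. unfold potential. rewrite Rabs_mult.
  apply Rmult_le_compat_l; [ apply Rabs_pos | apply hB ].
Qed.

Lemma vec_ext (t t' : nat -> R) (v : R * R) (k : nat) :
  (forall j, t j = t' j) -> vec t v k = vec t' v k.
Proof. intros h; induction k as [ | k IH]; cbn; [ reflexivity | now rewrite IH, h ]. Qed.

Lemma cocycle_iter_real (lam : R) (f : C -> C) (alpha E x : R) (k : nat) :
  (forall y : R, Im (f (RtoC y)) = 0) ->
  let t := fun j => E - lam * Re (f (RtoC (x + INR j * alpha))) in
  cocycle_iter lam f alpha E k (RtoC x)
  = [ [ RtoC (fst (vec t (1, 0) k)), RtoC (fst (vec t (0, 1) k)) ],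
      [ RtoC (snd (vec t (1, 0) k)), RtoC (snd (vec t (0, 1) k)) ] ].
Proof.
  intros hf t; induction k as [ | k IH]; [ reflexivity | ].
  assert (ht : (RtoC E - RtoC lam * f (RtoC x + RtoC (INR k * alpha)))%C = RtoC (t k)).
  { rewrite <- RtoC_plus. unfold t. specialize (hf (x + INR k * alpha)).
    destruct (f (RtoC (x + INR k * alpha))) as [a b]. cbn in hf |- *. subst b.
    unfold RtoC, Cmult, Cminus, Copp, Cplus; cbn; f_equal; ring. }
  cbn [cocycle_iter vec]. rewrite IH. unfold cocycle_mat. rewrite ht.
  set (P := vec t (1, 0) k). set (Q := vec t (0, 1) k).
  unfold Mmult, mk_matrix, mk_Tn, sl2_step; cbn [fst snd].
  unfold sum_n, sum_n_m; cbn.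
  repeat f_equal; unfold RtoC, Cmult, Cplus, zero, plus, mult; cbn; f_equal; ring.
Qed.

(** * Operator norms and matrix entries *)

Lemma Cmod_coeff_le (v : @matrix C 2 1) :
  col_norm v <= 1 ->
  Cmod (coeff_mat (RtoC 0) v 0 0) <= 1 /\ Cmod (coeff_mat (RtoC 0) v 1 0) <= 1.
Proof.
  unfold col_norm.
  set (a := Cmod (coeff_mat (RtoC 0) v 0 0)). set (b := Cmod (coeff_mat (RtoC 0) v 1 0)).
  intros h. assert (ha : 0 <= a) by apply Cmod_ge_0. assert (hb : 0 <= b) by apply Cmod_ge_0.
  assert (h2 : 0 <= a ^ 2 + b ^ 2) by nra.
  assert (hs := sqrt_sqrt _ h2). assert (h0 := sqrt_pos (a ^ 2 + b ^ 2)). split; nra.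
Qed.

Lemma col_norm_le_op_norm (a b c d : C) (v : @matrix C 2 1) :
  col_norm v <= 1 ->
  col_norm (Mmult (T := C_Ring) ([ [ a, b ], [ c, d ] ] : @matrix C 2 2) v)
  <= op_norm [ [ a, b ], [ c, d ] ].
Proof.
  intros hv. unfold op_norm.
  set (A := ([ [ a, b ], [ c, d ] ] : @matrix C 2 2)).
  set (S := fun l => exists v : @matrix C 2 1,
                col_norm v <= 1 /\ l = col_norm (Mmult (T := C_Ring) A v)).
  destruct (Lub_Rbar_correct S) as [hub hl].
  assert (hS : S (col_norm (Mmult (T := C_Ring) A v))) by (exists v; auto).
  assert (h1 := hub _ hS).
  (* An infinite supremum would be turned into 0 by [real], so finiteness has to be secured
     first. *)
  assert (h2 : Rbar_le (Lub_Rbar S) (Finite (Cmod a + Cmod b + (Cmod c + Cmod d)))).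
  { apply hl. intros l [w [hw ->]].
    destruct (Cmod_coeff_le w hw) as [w0 w1].
    assert (hrow : forall x y, Cmod (x * coeff_mat (RtoC 0) w 0 0
                                     + y * coeff_mat (RtoC 0) w 1 0)%C <= Cmod x + Cmod y).
    { intros x y. eapply Rle_trans; [ apply Cmod_triangle | ]. rewrite !Cmod_mult.
      assert (hx := Cmod_ge_0 x). assert (hy := Cmod_ge_0 y). nra. }
    assert (e0 : coeff_mat (RtoC 0) (Mmult (T := C_Ring) A w) 0 0
                 = (a * coeff_mat (RtoC 0) w 0 0 + b * coeff_mat (RtoC 0) w 1 0)%C).
    { unfold Mmult. rewrite coeff_mat_bij by lia. cbn [Nat.pred].
      rewrite sum_Sn, sum_O. reflexivity. }
    assert (e1 : coeff_mat (RtoC 0) (Mmult (T := C_Ring) A w) 1 0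
                 = (c * coeff_mat (RtoC 0) w 0 0 + d * coeff_mat (RtoC 0) w 1 0)%C).
    { unfold Mmult. rewrite coeff_mat_bij by lia. cbn [Nat.pred].
      rewrite sum_Sn, sum_O. reflexivity. }
    unfold col_norm. rewrite e0, e1.
    assert (r0 := hrow a b). assert (r1 := hrow c d).
    set (p := Cmod (a * _ + _)) in *. set (q := Cmod (c * _ + _)) in *.
    assert (hp : 0 <= p) by apply Cmod_ge_0. assert (hq : 0 <= q) by apply Cmod_ge_0.
    cbn. apply (Rle_trans _ (p + q)); [ | lra ].
    rewrite <- (sqrt_pow2 (p + q)) by lra. apply sqrt_le_1_alt. nra. }
  destruct (Lub_Rbar S) as [l | | ]; cbn in h1, h2 |- *; try contradiction. exact h1.
Qed.

Lemma entry_le_op_norm (a b c d : C) :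
  Cmod a <= op_norm [ [ a, b ], [ c, d ] ] /\ Cmod b <= op_norm [ [ a, b ], [ c, d ] ].
Proof.
  assert (hn : forall x y : C, col_norm ([ [ x ], [ y ] ] : @matrix C 2 1)
                 = sqrt (Cmod x ^ 2 + Cmod y ^ 2)) by reflexivity.
  assert (hge : forall x y : C, Cmod x <= sqrt (Cmod x ^ 2 + Cmod y ^ 2)).
  { intros x y. rewrite <- (sqrt_pow2 (Cmod x)) at 1 by apply Cmod_ge_0.
    apply sqrt_le_1_alt. assert (h := pow2_ge_0 (Cmod y)). lra. }
  assert (hm : forall x y : C,
    Mmult (T := C_Ring) ([ [ a, b ], [ c, d ] ] : @matrix C 2 2)
      ([ [ x ], [ y ] ] : @matrix C 2 1)
    = [ [ (a * x + b * y)%C ], [ (c * x + d * y)%C ] ]).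
  { intros x y. unfold Mmult, mk_matrix, mk_Tn, sum_n, sum_n_m; cbn.
    now rewrite !Cplus_0_r. }
  split.
  - eapply Rle_trans; [ | apply (col_norm_le_op_norm a b c d [ [ RtoC 1 ], [ RtoC 0 ] ]) ].
    + rewrite hm, hn. eapply Rle_trans; [ | apply hge ].
      apply Req_le; f_equal; ring.
    + rewrite hn, Cmod_1, Cmod_0. replace (1 ^ 2 + 0 ^ 2) with 1 by ring. rewrite sqrt_1; lra.
  - eapply Rle_trans; [ | apply (col_norm_le_op_norm a b c d [ [ RtoC 0 ], [ RtoC 1 ] ]) ].
    + rewrite hm, hn. eapply Rle_trans; [ | apply hge ].
      apply Req_le; f_equal; ring.
    + rewrite hn, Cmod_1, Cmod_0. replace (0 ^ 2 + 1 ^ 2) with 1 by ring. rewrite sqrt_1; lra.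
Qed.

Lemma op_norm_le_strip_norm (delta s : R) (A : C -> @matrix C 2 2) (x : R) :
  0 <= delta -> Rbar_le (strip_norm delta A) (Finite s) -> op_norm (A (RtoC x)) <= s.
Proof.
  intros hd h.
  assert (h1 : Rbar_le (Finite (op_norm (A (RtoC x)))) (strip_norm delta A)).
  { apply (proj1 (Lub_Rbar_correct _)). exists (RtoC x); split; [ | reflexivity ].
    unfold strip; cbn; rewrite Rabs_R0; exact hd. }
  exact (Rbar_le_trans _ _ _ h1 h).
Qed.

(** Starting the recursion at site [l] is the cocycle at the real phase [INR l * alpha], so one
    bound on the strip controls every block of the orbit. The factor 2 counts the two entries of the
    row. *)
Lemma row_le_strip_norm (lam : R) (f : C -> C) (alpha E delta s : R) (l k : nat) :
  (forall y : R, Im (f (RtoC y)) = 0) -> 0 <= delta ->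
  Rbar_le (strip_norm delta (cocycle_iter lam f alpha E k)) (Finite s) ->
  let t := fun i => E - potential lam f alpha (l + i) in
  dot (row t k) (row t k) <= 2 * s ^ 2.
Proof.
  intros hf hd hs t.
  apply (op_norm_le_strip_norm _ _ _ (INR l * alpha) hd) in hs.
  rewrite (cocycle_iter_real lam f alpha E (INR l * alpha) k hf) in hs.
  set (t' := fun j => E - lam * Re (f (RtoC (INR l * alpha + INR j * alpha)))) in hs.
  assert (ht : forall j, t' j = t j).
  { intros j. unfold t', t, potential. rewrite plus_INR. do 5 f_equal. ring. }
  rewrite !(vec_ext t' t _ k ht) in hs.
  match type of hs with op_norm [ [ ?a, ?b ], [ ?c, ?d ] ] <= _ =>
    destruct (entry_le_op_norm a b c d) as [h1 h2] end.
  rewrite Cmod_R in h1, h2.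
  unfold dot, row; cbn [fst snd].
  set (p := fst (vec t (1, 0) k)) in *. set (q := fst (vec t (0, 1) k)) in *.
  assert (hp : Rabs p <= s) by lra. assert (hq : Rabs q <= s) by lra.
  assert (hsq : forall z, Rabs z <= s -> z * z <= s ^ 2).
  { clear; intros z h; apply Rabs_le_between in h; nra. }
  assert (h3 := hsq p hp). assert (h4 := hsq q hq). lra.
Qed.

(** * Gap sets as level sets of the rotation number *)

Lemma rot_range (V : nat -> R) (B : R) :
  (forall k, Rabs (V k) <= B) -> forall E, 0 <= rot V E <= / 2.
Proof.
  intros hV E.
  assert (hV' : forall k, - B <= V k <= B) by (intros k; apply Rabs_le_between, hV).
  assert (h1 := rot_antitone V E (Rmax E (B + 2)) (Rmax_l _ _)).
  assert (h2 := rot_antitone V (Rmin E (- B - 2)) E (Rmin_l _ _)).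
  rewrite rot_right in h1
    by (intros k; specialize (hV' k); assert (h := Rmax_r E (B + 2)); lra).
  rewrite (rot_left V (Rmin E (- B - 2))) in h2
    by (intros k; specialize (hV' k); assert (h := Rmin_r E (- B - 2)); lra).
  lra.
Qed.

Lemma rot_continuity (V : nat -> R) (B : R) :
  (forall k, Rabs (V k) <= B) -> continuity (rot V).
Proof.
  intros hV E. apply continuity_pt_locally; intros eps.
  assert (he := cond_pos eps).
  destruct (rot_continuous V B hV E (eps / 2) ltac:(lra)) as [d [hd h]].
  exists (mkposreal d hd); intros E' hE'. specialize (h E' hE'). lra.
Qed.

Lemma rot_onto (V : nat -> R) (B y : R) :
  (forall k, Rabs (V k) <= B) -> 0 <= y <= / 2 -> exists E, rot V E = y.
Proof.
  intros hV hy.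
  assert (hV' : forall k, - B <= V k <= B) by (intros k; apply Rabs_le_between, hV).
  destruct (IVT_gen (rot V) (- B - 2) (B + 2) y (rot_continuity V B hV)) as [E [_ hE]].
  - rewrite rot_left, rot_right by (intros k; specialize (hV' k); lra).
    rewrite Rmin_right, Rmax_left by lra. exact hy.
  - now exists E.
Qed.

(* The value y of the rotation number on the gap lies strictly inside
   (0, 1/2) because m alpha is not an integer. *)
Lemma gap_set_value (lam : R) (f : C -> C) (alpha B : R) (m : Z) :
  (forall k, Rabs (potential lam f alpha k) <= B) -> irrational alpha -> m <> 0%Z ->
  exists y, 0 < y < / 2 /\
    forall E, gap_set lam f alpha m E <-> rot (potential lam f alpha) E = y.
Proof.
  intros hV hirr hm.
  destruct (archimed (IZR m * alpha)) as [a1 a2].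
  set (z := (up (IZR m * alpha) - 1)%Z).
  assert (hz : IZR z = IZR (up (IZR m * alpha)) - 1) by (unfold z; apply minus_IZR).
  assert (hne : IZR m * alpha <> IZR z).
  { intros e. apply (hirr z m hm). rewrite <- e. field. now apply not_0_IZR. }
  exists ((IZR m * alpha - IZR z) / 2); split; [ lra | ].
  intros E. unfold gap_set, eq_mod_Z. rewrite rho_rot. split.
  - intros [k hk]. assert (hr := rot_range _ B hV E).
    (* [2 * rot] lies in [0, 1] and the fractional part of [IZR m * alpha] strictly between 0 and 1,
       so the integer by which they differ is 0. *)
    assert (e : (k + z = 0)%Z).
    { assert (IZR (k + z) < 1) by (rewrite plus_IZR; lra).
      assert (- (1) < IZR (k + z)) by (rewrite plus_IZR; lra).
      apply lt_IZR in H. rewrite <- opp_IZR in H0. apply lt_IZR in H0. lia. }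
    apply (f_equal IZR) in e. rewrite plus_IZR in e. lra.
  - intros ->. exists (- z)%Z. rewrite opp_IZR. lra.
Qed.

Lemma Lub_Rbar_finite (S : R -> Prop) (x b : R) :
  S x -> (forall y, S y -> y <= b) ->
  (forall y, S y -> y <= real (Lub_Rbar S)) /\
  (forall c, (forall y, S y -> y <= c) -> real (Lub_Rbar S) <= c).
Proof.
  intros hx hb. destruct (Lub_Rbar_correct S) as [h1 h2].
  assert (h3 := h1 x hx). assert (h4 := h2 (Finite b) hb).
  destruct (Lub_Rbar S) as [l | | ]; cbn in h3, h4; try contradiction.
  split; [ exact h1 | intros c hc; exact (h2 (Finite c) hc) ].
Qed.

Lemma Glb_Rbar_ge (S : R -> Prop) (x c : R) :
  S x -> (forall y, S y -> c <= y) -> c <= real (Glb_Rbar S).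
Proof.
  intros hx hc. destruct (Glb_Rbar_correct S) as [h1 h2].
  assert (h3 := h1 x hx). assert (h4 := h2 (Finite c) hc).
  destruct (Glb_Rbar S) as [l | | ]; cbn in h3, h4; try contradiction. exact h4.
Qed.

(** The level set is nonempty by the intermediate value theorem, bounded above because [rot] is 0
    beyond [B + 2], and closed by continuity, so its supremum is attained. *)
Lemma E_plus_in_gap (lam : R) (f : C -> C) (alpha B : R) (m : Z) :
  (forall k, Rabs (potential lam f alpha k) <= B) -> irrational alpha -> m <> 0%Z ->
  gap_set lam f alpha m (E_plus lam f alpha m) /\
  forall E, gap_set lam f alpha m E -> E <= E_plus lam f alpha m.
Proof.
  intros hV hirr hm.
  destruct (gap_set_value lam f alpha B m hV hirr hm) as [y [hy hgap]].
  set (V := potential lam f alpha) in *.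
  assert (hV' : forall k, - B <= V k <= B) by (intros k; apply Rabs_le_between, hV).
  destruct (rot_onto V B y hV ltac:(lra)) as [E0 hE0].
  destruct (Lub_Rbar_finite (gap_set lam f alpha m) E0 (B + 2)) as [hub hlub].
  { now apply hgap. }
  { intros E hE. apply hgap in hE. destruct (Rle_lt_dec E (B + 2)) as [h | h]; [ exact h | ].
    rewrite rot_right in hE by (intros k; specialize (hV' k); lra). lra. }
  fold (E_plus lam f alpha m) in hub, hlub. set (Ep := E_plus lam f alpha m) in *.
  split; [ | exact hub ].
  apply hgap. destruct (Req_dec (rot V Ep) y) as [e | hne]; [ exact e | exfalso ].
  assert (hpos : 0 < Rabs (y - rot V Ep)) by (apply Rabs_pos_lt; lra).
  destruct (rot_continuous V B hV Ep (Rabs (y - rot V Ep) / 2) ltac:(lra)) as [d [hd hc]].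
  enough (Ep <= Ep - d / 2) by lra.
  apply hlub; intros E hE. assert (hle := hub E hE). apply hgap in hE.
  destruct (Rle_lt_dec E (Ep - d / 2)) as [h | h]; [ exact h | exfalso ].
  specialize (hc E ltac:(apply Rabs_def1; lra)). rewrite hE in hc. lra.
Qed.

Lemma E_plus_in_Sigma (lam : R) (f : C -> C) (alpha B : R) (m : Z) :
  (forall x : R, Im (f (RtoC x)) = 0) ->
  (forall k, Rabs (potential lam f alpha k) <= B) -> irrational alpha -> m <> 0%Z ->
  Sigma lam f alpha (E_plus lam f alpha m).
Proof.
  intros hf hV hirr hm hres.
  destruct (E_plus_in_gap lam f alpha B m hV hirr hm) as [hin hub].
  destruct (gap_set_value lam f alpha B m hV hirr hm) as [y [hy hgap]].
  set (Ep := E_plus lam f alpha m) in *. set (V := potential lam f alpha) in *.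
  destruct (resolvent_ang_bound lam f alpha Ep hf hres) as [eps [he hang]].
  apply rot_le_of_ang_const in hang. fold V in hang.
  assert (h1 := rot_antitone V (Ep - eps) Ep ltac:(lra)).
  assert (h2 := rot_antitone V Ep (Ep + eps) ltac:(lra)).
  apply hgap in hin.
  assert (h3 : gap_set lam f alpha m (Ep + eps)) by (apply hgap; lra).
  apply hub in h3. lra.
Qed.

Theorem theorem5p1 (C0 : R) (hC0 : 0 < C0) :
  exists C1min C2min : R,
    forall C1 C2 : R, C1min <= C1 -> C2min <= C2 ->
    forall (alpha eta : R) (f : C -> C)
           (theta : R -> R -> R) (u : R -> R -> Z -> C) (lam0 lam : R),
      irrational alpha ->
      Rbar_le (Finite 0) (beta alpha) ->
      Rbar_lt (beta alpha) p_infty ->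
      C1 * real (beta alpha) < eta ->
      real_analytic_on_strip (C2 * eta) f ->
      dual_choice f alpha theta u ->
      is_threshold C0 alpha eta f theta u lam0 ->
      0 < Rabs lam <= lam0 ->
      exists mstar : R,
        forall m : Z, m <> 0%Z -> mstar <= Rabs (IZR m) ->
          exists n : Z,
            is_resonance_index alpha (theta lam (E_plus lam f alpha m)) n /\
            E_plus lam f alpha m - E_minus lam f alpha m
              <= exp (- (eta / 3) * IZR n).
Proof.
  (* [12 * C0 * b < eta] makes the squared bound of (d), with exponent [2 * C0 * b * n], at most a
     constant times [exp (eta * n / 6)]. The 0 keeps [C2 * eta] nonnegative, so that the strip
     contains the real axis. *)
  exists (12 * C0), 0.
  intros C1 C2 hC1 hC2 alpha eta f theta u lam0 lam hirr hb0 hb1 heta hf _ [_ hthr] hlam.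
  assert (hb : 0 <= real (beta alpha)).
  { destruct (beta alpha); cbn in *; try contradiction; lra. }
  set (b := real (beta alpha)) in *.
  assert (hCb : 12 * C0 * b <= C1 * b) by (apply Rmult_le_compat_r; lra).
  assert (heta0 : 0 < eta) by nra.
  assert (hstrip : 0 <= C2 * eta) by nra.
  assert (hreal : forall x : R, Im (f (RtoC x)) = 0) by apply hf.
  destruct (potential_bounded _ lam f alpha hstrip hf) as [B hV].
  destruct (hthr lam hlam) as [Cstar [M hres]].
  set (Cs := Rabs Cstar + 1).
  assert (hCs : 1 <= Cs) by (unfold Cs; assert (h := Rabs_pos Cstar); lra).
  assert (hCs2 : 1 <= Cs ^ 2) by nra.
  (* The first entry meets the strict threshold of (b); the second then turns
     [Rabs (IZR m) <= C0 * IZR n] into [eta * n / 6 >= 2048 * Cs ^ 2]. The constant 2048 is what the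
     final count of steps asks of [X]. *)
  exists (Rmax (M + 1) (C0 * (6 * (2048 * Cs ^ 2) / eta))).
  intros m hm hml.
  assert (hm1 := Rmax_l (M + 1) (C0 * (6 * (2048 * Cs ^ 2) / eta))).
  assert (hm2 := Rmax_r (M + 1) (C0 * (6 * (2048 * Cs ^ 2) / eta))).
  destruct (E_plus_in_gap lam f alpha B m hV hirr hm) as [hin hub].
  assert (hSig := E_plus_in_Sigma lam f alpha B m hreal hV hirr hm).
  destruct (gap_set_value lam f alpha B m hV hirr hm) as [y [hy hgap]].
  destruct (hres _ m hSig hin) as [n [hn1 [hn2 [_ hn4]]]].
  specialize (hn2 ltac:(lra)).
  exists n; split; [ exact hn1 | ].
  set (Ep := E_plus lam f alpha m) in *. set (V := potential lam f alpha) in *.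
  assert (hn : 6 * (2048 * Cs ^ 2) / eta <= IZR n)
    by (apply (Rmult_le_reg_l C0); lra).
  assert (hn' : 2048 * Cs ^ 2 <= eta * IZR n / 6).
  { apply (Rmult_le_compat_l eta) in hn; [ | lra ].
    replace (eta * (6 * (2048 * Cs ^ 2) / eta)) with (6 * (2048 * Cs ^ 2)) in hn
      by (field; lra). lra. }
  (* With [X = exp a] everything becomes a power: [tau] is [X ^ 2] inverted, [D] is
     [2 * Cs ^ 2 * X], and (d) is valid for [X ^ 6] steps. *)
  set (a := eta * IZR n / 6) in *.
  set (X := exp a).
  assert (hX : 2048 * Cs ^ 2 <= X).
  { apply (Rle_trans _ _ _ hn'). left. unfold X.
    assert (h := exp_ineq1 a ltac:(lra)). lra. }
  set (tau := exp (- (eta / 3) * IZR n)).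
  assert (htau0 : 0 < tau) by apply exp_pos.
  assert (htau : tau * X ^ 2 = 1).
  { unfold tau, X. replace (exp a ^ 2) with (exp a * exp a) by ring.
    rewrite <- !exp_plus. rewrite <- exp_0. f_equal. unfold a. field. }
  assert (hK : exp (eta * IZR n) = X ^ 6).
  { unfold X. replace (exp a ^ 6) with (exp a * exp a * exp a * exp a * exp a * exp a) by ring.
    rewrite <- !exp_plus. f_equal. unfold a. field. }
  assert (hM : (Cstar * exp (C0 * b * IZR n)) ^ 2 <= Cs ^ 2 * X).
  { rewrite Rpow_mult_distr.
    assert (hn0 : 0 <= IZR n) by (unfold a in hn'; nra).
    apply Rmult_le_compat; try apply pow2_ge_0.
    - rewrite <- pow2_abs. apply pow_incr. split; [ apply Rabs_pos | unfold Cs; lra ].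
    - replace (exp (C0 * b * IZR n) ^ 2) with (exp (C0 * b * IZR n) * exp (C0 * b * IZR n))
        by ring.
      rewrite <- exp_plus.
      unfold X. destruct (Req_dec (C0 * b * IZR n + C0 * b * IZR n) a) as [-> | hne]; [ lra | ].
      left; apply exp_increasing. unfold a in *. nra. }
  set (D := 2 * (Cs ^ 2 * X)).
  assert (hgain : rot V Ep < rot V (Ep - tau)).
  { assert (hX6 : 0 <= X ^ 6 / 2) by (assert (h : 0 < X ^ 6) by (apply pow_lt; lra); lra).
    (* [2 * j] steps are the most that (d) allows. *)
    destruct (nfloor_ex (X ^ 6 / 2) hX6) as [j [hj1 hj2]].
    assert (hX1 : 1 <= X) by lra.
    assert (hX3 : X <= X ^ 3) by (assert (1 <= X ^ 2) by nra; nra).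
    assert (hX36 : X ^ 3 <= X ^ 6).
    { replace (X ^ 6) with (X ^ 3 * X ^ 3) by ring. nra. }
    assert (hj3 : X ^ 6 / 4 <= INR j) by lra.
    assert (hj0 : 0 < INR j) by lra.
    assert (hDp : 0 < D) by (unfold D; nra).
    apply (rot_gain V Ep tau D j).
    - lra.
    - apply INR_lt. exact hj0.
    - intros l k hk. unfold D.
      eapply Rle_trans; [ apply (row_le_strip_norm lam f alpha Ep eta
                                   (Cstar * exp (C0 * b * IZR n))) | ].
      + exact hreal.
      + lra.
      + apply hn4. rewrite hK. apply lt_INR in hk. rewrite mult_INR in hk. cbn in hk. lra.
      + lra.
    - apply (Rmult_le_reg_r (X ^ 2)); [ nra | ].
      replace (tau * D * X ^ 2) with (tau * X ^ 2 * D) by ring. rewrite htau.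
      unfold D. nra.
    - apply (Rmult_le_reg_r (X ^ 2)); [ nra | ]. rewrite htau. nra.
    - assert (hpi := PI_4).
      apply (Rle_trans _ 4); [ lra | ].
      replace tau with (/ X ^ 2) by (apply (Rmult_eq_reg_r (X ^ 2)); [ rewrite htau; field | ]; nra).
      apply (Rmult_le_reg_r (X ^ 2 * (64 * D))); [ nra | ].
      replace (INR j * (/ X ^ 2 / (64 * D)) * (X ^ 2 * (64 * D))) with (INR j)
        by (field; split; lra).
      unfold D.
      (* Since [j >= X ^ 6 / 4], it remains that [X ^ 3 >= 4 * 512 * Cs ^ 2], the source of 2048. *)
      replace (4 * (X ^ 2 * (64 * (2 * (Cs ^ 2 * X))))) with (512 * Cs ^ 2 * X ^ 3) by ring.
      apply (Rle_trans _ (X ^ 3 * X ^ 3 / 4)); [ nra | ].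
      replace (X ^ 3 * X ^ 3) with (X ^ 6) by ring. exact hj3. }
  enough (Ep - tau <= E_minus lam f alpha m) by lra.
  apply (Glb_Rbar_ge _ Ep); [ exact hin | ].
  intros E hE. destruct (Rle_lt_dec (Ep - tau) E) as [h | h]; [ exact h | exfalso ].
  apply hgap in hE. apply hgap in hin.
  assert (h1 := rot_antitone V E (Ep - tau) ltac:(lra)). fold V in hE, hin. lra.
Qed.
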